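(* Let $E$ be an open subset of $\mathbb{R}^d$ and let $f: E \rightarrow \mathbb{R}$ be a locally matrix monotone function. Then $f$ is (real) analytic on $E$.
   Context: For an open set $E \subset \mathbb{R}^d$ and $n \geq 1$, $CSAM^d_n(E)$ denotes the set of $d$-tuples $A=(A_1,\dots,A_d)$ of pairwise commuting self-adjoint (complex) $n\times n$ matrices whose joint spectrum is contained in $E$; that is, after a simultaneous unitary diagonalization, the $d$-tuples of corresponding diagonal entries (joint eigenvalues) are elements of $E$. For $f:E\to\mathbb{R}$ and $A \in CSAM^d_n(E)$, $f(A)$ is defined by the functional calculus: if $A_i = U\,\mathrm{diag}(\lambda^{(1)}_i,\dots,\lambda^{(n)}_i)\,U^*$ for all $i$, with $U$ unitary and $\lambda^{(j)}=(\lambda^{(j)}_1,\dots,\lambda^{(j)}_d)\in E$, then $f(A) = U\,\mathrm{diag}(f(\lambda^{(1)}),\dots,f(\lambda^{(n)}))\,U^*$. For self-adjoint matrices, $A\leq B$ means $B-A$ is positive semidefinite. A function $f: E \rightarrow \mathbb{R}$ (with no regularity assumed) is locally matrix monotone if for every $n\geq 1$ and every $C^1$ curve $\gamma: [0,1] \rightarrow CSAM^d_n(E)$ (i.e. $C^1$ as a curve of $d$-tuples of matrices) such that $\gamma'(t)_i \geq 0$ for all $i=1,\dots,d$ and all $t \in [0,1]$, one has: $t_1 \leq t_2$ implies $f(\gamma(t_1)) \leq f(\gamma(t_2))$ for $t_1,t_2\in[0,1]$. *)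

(* Defs.v *)
From HB Require Import structures.
From mathcomp Require Import all_boot all_order all_algebra.
From mathcomp Require Import finmap.
From mathcomp Require Import all_classical all_reals all_analysis.
From mathcomp Require Import complex.
From mathcomp Require summability.

Set Implicit Arguments.
Unset Strict Implicit.
Unset Printing Implicit Defensive.

Import Order.TTheory GRing.Theory Num.Theory.
Import numFieldNormedType.Exports.

Local Open Scope classical_set_scope.
Local Open Scope ring_scope.
Local Open Scope sesquilinear_scope.
Local Open Scope complex_scope.

Section Defs.
Context {R : realType}.

Definition psdmx n (M : 'M[R[i]]_n) : Prop :=
  M \is hermsymmx /\ forall v : 'cV[R[i]]_n, 0 <= (v ^t* *m M *m v) 0 0.

Definition loewner_le n (A B : 'M[R[i]]_n) : Prop := psdmx (B - A).

(* The real vector lam j collects the j-th diagonal entries of the matrices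
   U^* A_i U, that is, lam lists the joint eigenvalues of A. *)
Definition joint_diag d n (A : 'I_d -> 'M[R[i]]_n) (U : 'M[R[i]]_n)
    (lam : 'I_n -> 'rV[R]_d) : Prop :=
  U \is unitarymx /\
  forall i, A i = U *m diag_mx (\row_j (lam j 0 i)%:C) *m U ^t*.

(* By [csam_joint_diag] below, the last clause does not depend on the choice
   of the simultaneous diagonalization. *)
Definition csam d n (E : set 'rV[R]_d) (A : 'I_d -> 'M[R[i]]_n) : Prop :=
  [/\ forall i, A i \is hermsymmx,
      forall i j, A i *m A j = A j *m A i &
      exists U lam, joint_diag A U lam /\ forall j, E (lam j)].

(* By [fcalcE] below, this is U diag(f lam) U^* for every simultaneous unitary
   diagonalization (U, lam) of A. *)
Definition fcalc d n (f : 'rV[R]_d -> R) (A : 'I_d -> 'M[R[i]]_n) :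
    'M[R[i]]_n :=
  xget 0 [set B | exists U lam, joint_diag A U lam /\
    B = U *m diag_mx (\row_j (f (lam j))%:C) *m U ^t*].

(* g is C^1 on [0, 1] with derivative dg; the difference quotients are taken
   inside [0, 1], so the derivatives at 0 and 1 are one-sided and the values
   of g and dg outside [0, 1] are irrelevant. *)
Definition C1_with (g dg : R -> R) : Prop :=
  {within `[0, 1], continuous dg} /\
  forall t : R, t \in `[0, 1] ->
    (g s - g t) / (s - t) @[s --> within `[0, 1] t^'] --> dg t.

Definition C1_curve d n (gam dgam : R -> 'I_d -> 'M[R[i]]_n) : Prop :=
  forall i k l,
    C1_with (fun t => complex.Re (gam t i k l)) (fun t => complex.Re (dgam t i k l)) /\
    C1_with (fun t => complex.Im (gam t i k l)) (fun t => complex.Im (dgam t i k l)).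

Definition locally_matrix_monotone d (E : set 'rV[R]_d) (f : 'rV[R]_d -> R) :
    Prop :=
  forall n, (0 < n)%N -> forall gam dgam : R -> 'I_d -> 'M[R[i]]_n,
    C1_curve gam dgam ->
    (forall t : R, t \in `[0, 1] -> csam E (gam t)) ->
    (forall t : R, t \in `[0, 1] -> forall i, psdmx (dgam t i)) ->
    forall t1 t2 : R, t1 \in `[0, 1] -> t2 \in `[0, 1] -> t1 <= t2 ->
      loewner_le (fcalc f (gam t1)) (fcalc f (gam t2)).

(* f agrees near a with a convergent multivariate power series; the sum over
   multi-indices is unordered (a limit along the directed set of finite sets
   of multi-indices), hence absolutely convergent. *)
Definition real_analytic_at d (f : 'rV[R]_d -> R) (a : 'rV[R]_d) : Prop :=
  exists c : {ffun 'I_d -> nat} -> R, \forall x \near a,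
    summability.partial_sum
      (fun m : {ffun 'I_d -> nat} =>
         c m * \prod_(i < d) ((x : 'rV[R]_d) 0 i - a 0 i) ^+ m i)
      @ summability.totally --> f x.

Definition real_analytic_on d (E : set 'rV[R]_d) (f : 'rV[R]_d -> R) : Prop :=
  forall a, E a -> real_analytic_at f a.

Lemma joint_diag_intertwine d n (A : 'I_d -> 'M[R[i]]_n) U lam V mu :
  joint_diag A U lam -> joint_diag A V mu ->
  forall j k, (V ^t* *m U) j k != 0 -> mu j = lam k.
Proof.
move=> [Uu AU] [Vu AV] j k W0; apply/rowP => i.
have UU : U ^t* *m U = 1%:M.
  by move: Uu; rewrite -trmxC_unitary => /unitarymxP; rewrite trmxCK.
have VV : V ^t* *m V = 1%:M.
  by move: Vu; rewrite -trmxC_unitary => /unitarymxP; rewrite trmxCK.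
have : V ^t* *m A i *m U = V ^t* *m A i *m U by [].
rewrite {1}AV AU !mulmxA VV mul1mx -[RHS]mulmxA UU mulmx1 -mulmxA.
move=> /matrixP/(_ j k); rewrite mul_diag_mx mul_mx_diag !mxE.
rewrite mulrC => /mulfI; move: W0; rewrite mxE => /[swap]/[apply].
by case.
Qed.

Lemma fcalcE d n (f : 'rV[R]_d -> R) (A : 'I_d -> 'M[R[i]]_n) U lam :
  joint_diag A U lam ->
  fcalc f A = U *m diag_mx (\row_j (f (lam j))%:C) *m U ^t*.
Proof.
move=> dA; rewrite /fcalc; case: xgetP => [B _ [V [mu [dV ->]]]|/(_ _)]; last first.
  by move=> /(_ (U *m diag_mx (\row_j (f (lam j))%:C) *m U ^t*)) []; exists U, lam.
have itw := joint_diag_intertwine dA dV.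
have [/unitarymxP UU _] := dA; have [Vu _] := dV.
have VV : V *m V ^t* = 1%:M by exact/unitarymxP.
have eqW : diag_mx (\row_j (f (mu j))%:C) *m (V ^t* *m U) =
           (V ^t* *m U) *m diag_mx (\row_j (f (lam j))%:C).
  apply/matrixP => j k; rewrite mul_diag_mx mul_mx_diag [LHS]mxE [RHS]mxE.
  rewrite [(\row__ _) _ _]mxE [(\row__ _) _ _ in RHS]mxE.
  have [->|/itw ->] := eqVneq ((V ^t* *m U) j k) 0; first by rewrite mulr0 mul0r.
  by rewrite mulrC.
rewrite -[LHS]mulmx1 -UU !mulmxA.
rewrite -[X in X *m U ^t*]mulmxA -[X in X *m U ^t*]mulmxA eqW.
by rewrite !mulmxA VV mul1mx.
Qed.

Lemma csam_joint_diag d n (E : set 'rV[R]_d) (A : 'I_d -> 'M[R[i]]_n) U lam :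
  csam E A -> joint_diag A U lam -> forall j, E (lam j).
Proof.
move=> [_ _ [V [mu [dV Emu]]]] dU k.
have [/existsP[j Wj]|] := boolP [exists j, (V ^t* *m U) j k != 0].
  by rewrite -(joint_diag_intertwine dU dV Wj).
rewrite negb_exists => /forallP W0.
have [Uu _] := dU; have [/unitarymxP VV _] := dV.
have UU : U ^t* *m U = 1%:M.
  by move: Uu; rewrite -trmxC_unitary => /unitarymxP; rewrite trmxCK.
have : (U ^t* *m V *m (V ^t* *m U)) k k = 1.
  by rewrite !mulmxA -(mulmxA _ V) VV mulmx1 UU mxE eqxx.
rewrite mxE big1 => [/esym/eqP|j _]; first by rewrite oner_eq0.
by have /negPn/eqP -> := W0 j; rewrite mulr0.
Qed.

End Defs.

(* Main.v *)
Require Import Defs.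
From mathcomp Require Import all_boot all_order all_algebra.
From mathcomp Require Import finmap qpoly.
From mathcomp Require Import all_classical all_reals all_analysis.
From mathcomp Require Import complex.
From mathcomp Require summability.
From mathcomp Require Import ring lra zify.

(** The proof stays with finite sums: no derivative of f is ever taken.

    Around a point of E put a cube contained in E, rescaled to [-1, 1]^d.

    Along a line parallel to a coordinate axis, f satisfies Loewner's
    condition: the divided difference of f h^2 over any 2n distinct nodes is
    nonnegative when h is a real polynomial of degree less than n
    ([locally_matrix_monotone_loewner]). Indeed a divided difference gives the
    node x the weight 1 / omega'(x), where omega is the monic polynomial with
    roots the nodes, and this weight is positive at n nodes and negative at n
    nodes. Since divided differences over 2n nodes vanish on polynomials of
    degree at most 2n - 2, the nodes mu of positive weight and the nodes lam
    of negative weight define the same inner product on polynomials of degree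
    less than n. Multiplication by the variable, interpolated at mu or at lam,
    gives two symmetric operators B and A with spectra mu and lam, and B - A
    has rank one and is positive, its quadratic form being the square of the
    coefficient of degree n - 1 ([interlacing_pair]). On the segment from A to
    B, placed in one coordinate while the others stay scalar, the hypothesis
    says f(A) <= f(B), and the quadratic form of f(B) - f(A) at h is the
    divided difference of f h^2.

    Taking for h a product of factors x - y over n - 1 of the nodes, one finds
    that the divided difference of f prod_y (x - y) over the n + 1 other nodes
    is nonnegative ([dd_prod_ge0]). Playing points y on both sides of [-1/4,
    1/4] against each other bounds all divided differences over m + 2 nodes in
    this interval by 12 M 4^m, where M bounds f ([loewner_dd_bound]). Such an
    M exists because f is monotone in each coordinate
    ([locally_matrix_monotone_le]).

    These bounds hold uniformly on all axis-parallel lines, and this suffices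
    for joint analyticity: the tensor product of the Lagrange interpolations
    of degree N at equispaced nodes of [0, delta] differs from f on the cube
    [-delta, delta]^d by at most C 2^-N once delta is small ([interp_error],
    [power_series_of_dd_bound]), because the interpolation error in one
    variable is a divided difference times (2 delta)^(N + 1), while Lagrange
    polynomials grow geometrically at a rate independent of delta. Hence the
    coefficients of the interpolants form Cauchy sequences, and their limits
    are the coefficients of a power series with sum f ([power_series_limit]). *)

Set Implicit Arguments.
Unset Strict Implicit.
Unset Printing Implicit Defensive.

Import Order.TTheory GRing.Theory Num.Theory.
Import numFieldNormedType.Exports.

Local Open Scope classical_set_scope.
Local Open Scope ring_scope.

(** * Divided differences *)

Section DividedDifferences.
Variable F : fieldType.
Implicit Types (s : seq F) (g h : F -> F) (p : {poly F}).

(** For a node [x] of [s] this is [omega' x], where [omega] is the monic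
    polynomial whose simple roots are the elements of [s]. *)
Definition node_prod s (x : F) := \prod_(y <- s | y != x) (x - y).

(** The divided difference of [g] on the nodes [s], in Lagrange's symmetric
    form, which asks for no order on the nodes and no regularity of [g]. *)
Definition dd s g := \sum_(x <- s) g x / node_prod s x.

Lemma node_prod_neq0 s x : node_prod s x != 0.
Proof.
rewrite prodf_seq_neq0; apply/allP => y _; apply/implyP.
by rewrite subr_eq0 eq_sym.
Qed.

Lemma eq_dd s g h : {in s, g =1 h} -> dd s g = dd s h.
Proof. by move=> gh; apply: eq_big_seq => x /gh ->. Qed.

Lemma perm_dd s1 s2 g : perm_eq s1 s2 -> dd s1 g = dd s2 g.
Proof.
move=> s12; rewrite /dd (perm_big _ s12); apply: eq_bigr => x _.
by rewrite /node_prod (perm_big _ s12).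
Qed.

Lemma ddD s g h : dd s (fun x => g x + h x) = dd s g + dd s h.
Proof. by rewrite -big_split; apply: eq_bigr => x _; rewrite mulrDl. Qed.

Lemma ddZ s c g : dd s (fun x => c * g x) = c * dd s g.
Proof. by rewrite /dd mulr_sumr; apply: eq_bigr => x _; rewrite mulrA. Qed.

Lemma ddB s g h : dd s (fun x => g x - h x) = dd s g - dd s h.
Proof.
rewrite -mulN1r -ddZ -ddD; apply: eq_dd => x _.
by rewrite mulN1r.
Qed.

(** The zero of the factor cancels the node it sits at. *)
Lemma dd_consM a s g : a \notin s -> dd (a :: s) (fun x => (x - a) * g x) = dd s g.
Proof.
move=> as_; rewrite /dd big_cons subrr !mul0r add0r; apply: eq_big_seq => x xs.
have ax : a != x by apply: contraNneq as_ => ->.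
by rewrite /node_prod big_cons ax invfM mulrACA mulfV ?mul1r // subr_eq0 eq_sym.
Qed.

Lemma dd_catM s1 s2 g : uniq (s1 ++ s2) ->
  dd (s1 ++ s2) (fun x => (\prod_(y <- s1) (x - y)) * g x) = dd s2 g.
Proof.
elim: s1 => [_|a s1 IHs /= /andP[as_ us]].
  by apply: eq_dd => x _; rewrite big_nil mul1r.
rewrite -IHs // -(dd_consM _ as_); apply: eq_dd => x _.
by rewrite big_cons mulrA.
Qed.

(** From [dd_consM], since [(x - b) - (x - a) = a - b]. *)
Lemma dd_rec a b s g : uniq [:: a, b & s] ->
  (a - b) * dd [:: a, b & s] g = dd (a :: s) g - dd (b :: s) g.
Proof.
move=> /[dup] uabs; rewrite /= inE negb_or => /andP[/andP[ab as_] /andP[bs us]].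
have perm_ab : perm_eq [:: a, b & s] [:: b, a & s].
  by apply/permP => P /=; rewrite addnCA.
rewrite -ddZ (eq_dd (h := fun x => (x - b) * g x - (x - a) * g x));
  last by move=> x _; ring.
rewrite ddB (perm_dd _ perm_ab) dd_consM ?inE ?negb_or ?bs ?andbT 1?eq_sym//.
by rewrite dd_consM // inE negb_or ab.
Qed.

Lemma dd1 s : uniq s -> (1 < size s)%N -> dd s (fun=> 1) = 0.
Proof.
have [n] := ubnP (size s); elim: n s => // n IHn [|a [|b s]] //= sn us _.
have ab : a - b != 0.
  by rewrite subr_eq0; move: us; rewrite /= inE negb_or => /andP[/andP[]].
apply: (mulfI ab); rewrite mulr0 dd_rec //; case: s => [|c s] in sn us *.
  by rewrite /dd /node_prod !big_cons !big_nil !eqxx /= subrr.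
move: us; rewrite /= !inE !negb_or => /andP[/and3P[_ ac as_] /andP[/andP[bc bs] us]].
by rewrite !IHn ?subrr //= ?inE ?negb_or ?ac ?bc ?as_ ?bs.
Qed.

(** Divided differences are the functionals that vanish on polynomials of low
    degree and read off the next coefficient: dividing p by 'X - a and using
    [dd_consM] removes one node and one degree at a time. *)
Lemma dd_horner s p : uniq s -> (0 < size s)%N -> (size p <= size s)%N ->
  dd s (horner p) = p`_(size s).-1.
Proof.
elim: s p => // a s IHs p us _ sp.
case: s => [|b s] in IHs us sp *.
  rewrite /dd /node_prod !big_cons !big_nil !eqxx /= divr1 addr0.
  by rewrite [p]size1_polyC // hornerC coefC eqxx.
have /factor_theorem[q pq] : root (p - p.[a]%:P) a.
  by rewrite /root !hornerE subrr.
have {}pq : p = q * ('X - a%:P) + p.[a]%:P by rewrite -pq subrK.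
have sq : (size q <= size (b :: s))%N.
  have [->|q0] := eqVneq q 0; first by rewrite size_poly0.
  rewrite -ltnS; have <- : size (q * ('X - a%:P)) = (size q).+1.
    by rewrite size_Mmonic ?monicXsubC // size_XsubC addn2.
  have -> : q * ('X - a%:P) = p - p.[a]%:P by rewrite {1}pq addrK.
  rewrite (leq_trans (size_polyD _ _)) // geq_max sp size_polyN.
  by rewrite (leq_trans (size_polyC_leq1 _)).
have [as_ us'] : a \notin b :: s /\ uniq (b :: s) by case/andP: us.
rewrite (eq_dd (h := fun x => (x - a) * q.[x] + p.[a] * 1)); last first.
  by move=> x _; rewrite {1}pq !hornerE; ring.
rewrite ddD dd_consM // ddZ dd1 // mulr0 addr0 IHs // pq /=.
rewrite coefD coefC /= addr0 mulrBr coefB coefMX coefMC /=.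
by rewrite [q`_(size s).+1]nth_default // mul0r subr0.
Qed.

End DividedDifferences.

(** * Interlacing pairs of matrices *)

Section Interlacing.
Variable R : rcfType.
Implicit Types (s : seq R) (g : R -> R) (p h : {poly R}).

(** A polynomial vanishing on the nodes of one sign would have a square with
    nonzero divided difference if there were fewer than half of them. *)
Lemma half_nodes_sign s n (c : R) (P : pred R) : (0 < n)%N -> uniq s ->
  size s = n.*2 ->
  {in s, forall x, P x -> 0 < c * node_prod s x} ->
  (n <= size [seq x <- s | ~~ P x])%N.
Proof.
move=> n0 us sn Pc; rewrite leqNgt; apply/negP => sPn.
pose p := \prod_(y <- [seq x <- s | ~~ P x]) ('X - y%:P).
have sp : size p = (size [seq x <- s | ~~ P x]).+1 by rewrite size_prod_XsubC.
have sp2 : (size (p ^+ 2)%R < n.*2)%N.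
  rewrite expr2 size_Mmonic ?monic_neq0 ?monic_prod_XsubC // sp.
  by rewrite -addnn; lia.
have : 0 < c^-1 * dd s (horner (p ^+ 2)).
  rewrite /dd mulr_sumr.
  have [x xs Px] : exists2 x, x \in s & P x.
    have := count_predC P s; rewrite -!size_filter sn => sE.
    have : (0 < size [seq x <- s | P x])%N.
      by rewrite -(ltn_add2r (size [seq x <- s | predC P x])) sE add0n
        (leq_trans sPn) // -addnn leq_addr.
    rewrite -has_predT => /hasP[x]; rewrite mem_filter => /andP[Px xs] _.
    by exists x.
  rewrite (bigD1_seq x) //= ltr_wpDr //.
    rewrite big_seq_cond; apply: sumr_ge0 => y /andP[ys _].
    have [Py|nPy] := boolP (P y); last first.
      rewrite (_ : (p ^+ 2).[y] = 0) ?mul0r ?mulr0 // !hornerE.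
      rewrite (_ : p.[y] = 0) ?mulr0 ?expr0n //.
      by apply/rootP; rewrite root_prod_XsubC mem_filter nPy.
    by rewrite mulrCA -invfM !hornerE mulr_ge0 ?sqr_ge0 // invr_ge0 ltW ?Pc.
  rewrite mulrCA -invfM !hornerE mulr_gt0 ?invr_gt0 ?Pc //.
  rewrite exprn_even_gt0 //= -/(root p x) root_prod_XsubC mem_filter.
  by rewrite Px.
rewrite dd_horner ?sn ?double_gt0 // ?(ltnW sp2) // nth_default ?mulr0 ?ltxx //.
by move: sp2; case: (n) n0 => // m _; rewrite doubleS ltnS.
Qed.

(** Divided differences as a difference of two positive sums with equally many
    terms: the nodes [mu] where [omega'] is positive and the nodes [lam] where it is
    negative.  Counting both families replaces an ordering of the nodes. *)
Lemma signed_nodes s n : (0 < n)%N -> uniq s -> size s = n.*2 ->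
  exists mu lam wmu wlam : 'I_n -> R,
  [/\ injective mu /\ injective lam,
      forall i, mu i \in s /\ lam i \in s,
      forall i, 0 < wmu i /\ 0 < wlam i &
      forall g, dd s g =
        \sum_i wmu i * g (mu i) - \sum_i wlam i * g (lam i)].
Proof.
move=> n0 us sn; pose W := node_prod s.
have W0 x : W x != 0 by exact: node_prod_neq0.
pose sp := [seq x <- s | 0 < W x]; pose sm := [seq x <- s | ~~ (0 < W x)].
have smE : sm = [seq x <- s | W x < 0].
  by apply: eq_filter => x; rewrite -leNgt le_eqVlt (negbTE (W0 x)).
have ssum : (size sp + size sm = n.*2)%N.
  by rewrite !size_filter -sn -(count_predC (fun x => 0 < W x) s).
have smn : (n <= size sm)%N.
  by apply: (half_nodes_sign (c := 1)) => // x _; rewrite mul1r.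
have spn : (n <= size sp)%N.
  have -> : sp = [seq x <- s | ~~ (W x < 0)].
    by apply: eq_filter => x; rewrite -leNgt le_eqVlt eq_sym (negbTE (W0 x)).
  by apply: (half_nodes_sign (c := -1)) => // x _ ?; rewrite mulN1r oppr_gt0.
have [{}spn {}smn] : size sp = n /\ size sm = n by move: ssum; rewrite -addnn; lia.
have inj r : uniq r -> size r = n -> injective (fun i : 'I_n => nth 0 r i).
  by move=> ur rn i j /eqP; rewrite nth_uniq ?rn // => /eqP /val_inj.
exists (fun i => nth 0 sp i), (fun i => nth 0 sm i).
exists (fun i => (W (nth 0 sp i))^-1), (fun i => (- W (nth 0 sm i))^-1).
have memp (i : 'I_n) : nth 0 sp i \in sp by rewrite mem_nth // spn.
have memm (i : 'I_n) : nth 0 sm i \in sm by rewrite mem_nth // smn.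
split.
- by split; apply: inj; rewrite // filter_uniq.
- by move=> i; split; [have := memp i | have := memm i]; rewrite mem_filter => /andP[].
- move=> i; rewrite !invr_gt0 oppr_gt0; split.
    by have := memp i; rewrite mem_filter => /andP[].
  by have := memm i; rewrite smE mem_filter => /andP[].
- move=> g; rewrite /dd (bigID (fun x => 0 < W x)) /=.
  rewrite -big_filter -[X in _ + X]big_filter -/sp -/sm.
  rewrite (big_nth 0) [X in _ + X](big_nth 0) !big_mkord spn smn -sumrN; congr (_ + _).
    by apply: eq_bigr => i _; rewrite mulrC.
  by apply: eq_bigr => i _; rewrite invrN mulNr opprK mulrC.
Qed.

(** The matrix of evaluation at the points [a], from coefficients of polynomials
    to the Euclidean space with the weights [w] absorbed by square roots. *)
Definition wvandermonde n (a w : 'I_n -> R) : 'M[R]_n :=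
  \matrix_(i, k) (Num.sqrt (w i) * a i ^+ k).

Lemma wvandermonde_unit n (a w : 'I_n -> R) : injective a ->
  (forall i, 0 < w i) -> wvandermonde a w \in unitmx.
Proof.
move=> a_inj w0; pose A := Vandermonde n (\row_i a i).
have -> : wvandermonde a w = diag_mx (\row_i Num.sqrt (w i)) *m A^T.
  by apply/matrixP => i k; rewrite mul_diag_mx !mxE.
rewrite unitmx_mul unitmx_tr !unitmxE det_diag det_Vandermonde !unitfE.
apply/andP; split; apply/prodf_neq0 => i _; first by rewrite mxE gt_eqF ?sqrtr_gt0.
apply/prodf_neq0 => j ij; rewrite !mxE subr_eq0 (inj_eq a_inj).
by apply: contraTneq ij => ->; rewrite ltnn.
Qed.

Lemma wvandermonde_gram n (a w : 'I_n -> R) g : (forall i, 0 < w i) ->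
  (wvandermonde a w)^T *m diag_mx (\row_i g (a i)) *m wvandermonde a w =
  \matrix_(k, l) \sum_i w i * (g (a i) * a i ^+ (k + l)).
Proof.
move=> w0; apply/matrixP => k l; rewrite !mxE; apply: eq_bigr => i _.
rewrite mul_mx_diag !mxE exprD -[in RHS](sqr_sqrtr (ltW (w0 i))); ring.
Qed.

Lemma wvandermonde_mul n (a w : 'I_n -> R) h : (size h <= n)%N ->
  wvandermonde a w *m (\col_k h`_k) =
  \col_i (Num.sqrt (w i) * h.[a i]).
Proof.
move=> hn; apply/matrixP => i j; rewrite !mxE (horner_coef_wide _ hn) mulr_sumr.
by apply: eq_bigr => k _; rewrite !mxE; ring.
Qed.

(** In coordinates of the common inner product, [Q] turns evaluation at [lam]
    into evaluation at [mu]; it is orthogonal because divided differences over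
    [n.*2] nodes kill [x ^ (k + l)] for [k, l < n].  The same computation with the
    factor [x] leaves the single entry [k = l = n.-1], hence the rank one term
    [u *m u^T].  The vector [v] lists the weighted values of [h] at [lam]. *)
Lemma interlacing_pair s n : (0 < n)%N -> uniq s -> size s = n.*2 ->
  exists (mu lam : 'I_n -> R) (Q : 'M[R]_n) (u : 'cV[R]_n),
  [/\ forall i, mu i \in s /\ lam i \in s,
      Q^T *m Q = 1%:M,
      Q^T *m diag_mx (\row_i mu i) *m Q - diag_mx (\row_i lam i) = u *m u^T &
      forall h, (size h <= n)%N -> exists v : 'cV[R]_n, forall g,
        dd s (fun x => g x * h.[x] ^+ 2) =
        (v^T *m (Q^T *m diag_mx (\row_i g (mu i)) *m Q
                 - diag_mx (\row_i g (lam i))) *m v) 0 0].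
Proof.
move=> n0 us sn; have [mu [lam [wm [wl [[imu ilam] mem w0 ddE]]]]] := signed_nodes n0 us sn.
have wm0 i : 0 < wm i by have [] := w0 i.
have wl0 i : 0 < wl i by have [] := w0 i.
pose VB := wvandermonde mu wm; pose VA := wvandermonde lam wl.
have uVA : VA \in unitmx by exact: wvandermonde_unit.
have [Q QE] : exists (Q : 'M[R]_n), Q *m VA = VB.
  by exists (VB *m invmx VA); rewrite mulmxKV.
have conjE X : VA^T *m (Q^T *m X *m Q) *m VA = VB^T *m X *m VB.
  by rewrite -QE trmx_mul !mulmxA.
have gramE g : VB^T *m diag_mx (\row_i g (mu i)) *m VB
    - VA^T *m diag_mx (\row_i g (lam i)) *m VA =
    \matrix_(k < n, l < n) dd s (fun x => g x * x ^+ (k + l)).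
  rewrite !wvandermonde_gram //; apply/matrixP => k l; rewrite !mxE.
  by rewrite ddE.
have VAinj X Y : VA^T *m X *m VA = VA^T *m Y *m VA -> X = Y.
  move=> /(congr1 (fun Z => Z *m invmx VA)); rewrite !mulmxK // => /(congr1 (fun Z => invmx VA^T *m Z)).
  by rewrite !mulKmx ?unitmx_tr.
have ddX (d : nat) : (d < n.*2)%N -> dd s (fun x => x ^+ d) = (d == n.*2.-1)%:R.
  move=> dn; rewrite (eq_dd (h := horner 'X^d)); last by move=> x _; rewrite hornerXn.
  by rewrite dd_horner ?size_polyXn // ?sn ?double_gt0 // coefXn eq_sym.
have diag1 : diag_mx (\row__ 1) = 1%:M :> 'M[R]_n.
  by apply/matrixP => i j; rewrite !mxE.
have QQ : Q^T *m Q = 1%:M.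
  apply: VAinj; rewrite -[Q^T]mulmx1 conjE !mulmx1; apply/eqP; rewrite -subr_eq0; apply/eqP.
  have := gramE (fun=> 1); rewrite !diag1 !mulmx1 => ->; apply/matrixP => k l; rewrite !mxE.
  rewrite (eq_dd (h := fun x => x ^+ (k + l))) ?ddX //; last by move=> x _; rewrite mul1r.
    by have := ltn_ord k; have := ltn_ord l; rewrite -addnn; case: eqP => //; lia.
  by have := ltn_ord k; have := ltn_ord l; rewrite -addnn; lia.
pose e : 'cV[R]_n := \col_k (k == n.-1 :> nat)%:R.
exists mu, lam, Q, (invmx VA^T *m e); split => //.
- apply: VAinj; rewrite mulmxBr mulmxBl conjE.
  have /= := gramE id => ->.
  rewrite trmx_mul trmx_inv trmxK !mulmxA mulmxV ?unitmx_tr // mul1mx mulmxKV //.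
  apply/matrixP => k l; rewrite !mxE big_ord1 !mxE.
  rewrite (eq_dd (h := fun x => x ^+ (k + l).+1)); last by move=> x _; rewrite exprS.
  have kn := ltn_ord k; have ln := ltn_ord l.
  rewrite ddX -?addnn; last lia.
  rewrite -natrM mulnb; congr (_%:R); lia.
- move=> h hn; exists (VA *m \col_k h`_k) => g.
  rewrite mulmxBr mulmxBl trmx_mul !mulmxA.
  have -> : (\col_k h`_k)^T *m VA^T *m Q^T *m diag_mx (\row_i g (mu i)) *m Q *m VA
     *m (\col_k h`_k : 'cV_n) = (VB *m \col_k h`_k)^T *m diag_mx (\row_i g (mu i)) *m (VB *m \col_k h`_k).
    by rewrite -QE !trmx_mul !mulmxA.
  rewrite -[X in _ - X]mulmxA -[in X in _ - X]trmx_mul !wvandermonde_mul // ddE.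
  have quadE (a w : 'I_n -> R) : (forall i, 0 < w i) ->
      ((\col_i (Num.sqrt (w i) * h.[a i]))^T *m diag_mx (\row_i g (a i)) *m
       (\col_i (Num.sqrt (w i) * h.[a i]))) 0 0 = \sum_i w i * (g (a i) * h.[a i] ^+ 2).
    move=> wp; rewrite mxE; apply: eq_bigr => i _; rewrite mul_mx_diag !mxE.
    by rewrite -[in RHS](sqr_sqrtr (ltW (wp i))); ring.
  by rewrite [RHS]mxE [X in _ = _ + X]mxE !quadE.
Qed.

End Interlacing.

(** * Bounds from Loewner's condition *)

Section LoewnerCondition.
Variable R : realFieldType.
Implicit Types (s Y : seq R) (g : R -> R) (h : {poly R}).

(** The finite form of Loewner's condition for matrix monotonicity, meaningful
    without any regularity of [g]. *)
Definition loewner g := forall n s h, uniq s -> size s = n.*2 -> (size h <= n)%N ->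
  {in s, forall x, `|x| <= 1} -> 0 <= dd s (fun x => g x * h.[x] ^+ 2).

Variable g : R -> R.
Hypothesis gL : loewner g.

(** The square of the product of the [x - y] kills the nodes [y] and leaves a
    single copy of that product. *)
Lemma dd_prod_ge0 s Y : uniq (Y ++ s) -> size s = (size Y).+2 ->
  {in Y ++ s, forall x, `|x| <= 1} ->
  0 <= dd s (fun x => (\prod_(y <- Y) (x - y)) * g x).
Proof.
move=> uYs sY Ys1; have := gL (n := (size Y).+1) (h := \prod_(y <- Y) ('X - y%:P)) uYs.
rewrite size_cat sY size_prod_XsubC -addnn addSn !addnS => /(_ erefl (leqnn _) Ys1).
rewrite -[X in _ -> 0 <= X](dd_catM _ uYs); congr (0 <= _); apply: eq_dd => x _.
rewrite horner_prod mulrC expr2 -mulrA; congr (_ * (_ * _)).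
all: by apply: eq_bigr => y _; rewrite hornerXsubC.
Qed.

(** Points of [1/2, 1[, pairwise distinct so that they may all serve as nodes,
    and away from the interval [-1/4, 1/4] that contains the nodes under study. *)
Definition outer_node k : R := 1 - (k.+2)%:R^-1.

Lemma outer_node_bounds k : 2^-1 <= outer_node k <= 1.
Proof.
rewrite /outer_node gerBl invr_ge0 ler0n andbT lerBrDr addrC -lerBrDr.
have -> : 1 - 2^-1 = 2^-1 :> R by lra.
by rewrite lef_pV2 ?posrE ?ltr0n // ler_nat.
Qed.

Lemma outer_node_lt k : outer_node k < outer_node k.+1.
Proof. by rewrite ltrD2l ltrN2 ltf_pV2 ?posrE ?ltr0n // ltr_nat. Qed.

Variable s : seq R.
Hypotheses (us : uniq s) (s4 : {in s, forall x, `|x| <= 4^-1}).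

(** Replace one factor at a time: with [c := outer_node k], both [x] and [1] are
    combinations of [x + c] and [x - c], by [x = ((x + c) + (x - c)) / 2] and
    [1 = ((x + c) - (x - c)) / (2 c)].  So an extra [x] averages two nonnegative
    quantities, and an extra [1] costs at most a factor [2] as [c >= 1/2]. *)
Lemma dd_pow_outer Y k a : size s = (size Y + k).+2 -> uniq Y ->
  {in Y, forall y, outer_node k <= `|y| <= 1} -> (a <= k)%N ->
  `|dd s (fun x => (\prod_(y <- Y) (x - y)) * x ^+ a * g x)|
    <= 2 ^+ (k - a) * dd s (fun x => (\prod_(y <- Y) (x - y)) * x ^+ k * g x).
Proof.
elim: k a Y => [|k IHk] a Y sY uY Yk.
  rewrite leqn0 => /eqP ->; rewrite subnn expr0 mul1r.
  rewrite (eq_dd (h := fun x => (\prod_(y <- Y) (x - y)) * g x));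
    last by move=> x _; rewrite mulr1.
  rewrite addn0 in sY; rewrite ger0_norm //; apply: dd_prod_ge0 => //.
    rewrite cat_uniq uY us andbT; apply/hasPn => x /s4 x4; apply/negP => /Yk.
    by have := outer_node_bounds 0; lra.
  move=> x; rewrite mem_cat => /orP[/Yk/andP[]//|/s4]; lra.
move=> ak; have c0 := outer_node_bounds k; pose c := outer_node k.
have cY y : y \in Y -> c < `|y|.
  by move=> /Yk /andP[+ _]; apply: lt_le_trans; exact: outer_node_lt.
pose q x := \prod_(y <- Y) (x - y).
pose D d b := dd s (fun x => (x - d) * q x * x ^+ b * g x).
have IH d b : `|d| = c -> (b <= k)%N -> `|D d b| <= 2 ^+ (k - b) * D d k.
  move=> dc bk; have := IHk b (d :: Y).
  have DE e : dd s (fun x => (\prod_(y <- d :: Y) (x - y)) * x ^+ e * g x) = D d e.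
    by apply: eq_dd => x _; rewrite big_cons.
  rewrite !DE; apply => //.
  - by rewrite sY /= addnS.
  - by rewrite /= uY andbT; apply/negP => /cY; rewrite dc ltxx.
  - move=> y; rewrite inE => /orP[/eqP ->|yY].
      by rewrite dc; case/andP: c0 => _ ->; rewrite lexx.
    by rewrite (ltW (cY _ yY)); case/andP: (Yk _ yY).
have cp : `|c| = c by rewrite ger0_norm // /c; lra.
have cn : `|- c| = c by rewrite normrN.
have c2 : 2^-1 <= c by rewrite /c; lra.
have cn0 : c != 0 by rewrite gt_eqF //; lra.
have splitX b : dd s (fun x => q x * x ^+ b.+1 * g x) = 2^-1 * (D c b + D (- c) b).
  by rewrite -ddD -ddZ; apply: eq_dd => x _; rewrite exprS; field.
have constE b : dd s (fun x => q x * x ^+ b * g x) = (2 * c)^-1 * (D (- c) b - D c b).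
  by rewrite -ddB -ddZ; apply: eq_dd => x _; field.
have Dk d : `|d| = c -> 0 <= D d k.
  by move=> dc; have := IH _ _ dc (leqnn k); rewrite subnn mul1r; apply: le_trans.
change (`|dd s (fun x => q x * x ^+ a * g x)|
  <= 2 ^+ (k.+1 - a) * dd s (fun x => q x * x ^+ k.+1 * g x)).
have [ak' | ka] := leqP a k; last first.
  have -> : a = k.+1 by apply/eqP; rewrite eqn_leq ak.
  rewrite subnn mul1r splitX ger0_norm // mulr_ge0 ?invr_ge0 // addr_ge0 ?Dk //.
rewrite constE splitX subSn // exprS.
have := IH _ _ cp ak'; have := IH _ _ cn ak'; have := Dk _ cp; have := Dk _ cn.
set e := 2 ^+ (k - a); set x := D _ k; set y := D _ k; set u := D _ a; set v := D _ a.
move=> x0 y0 ux vy.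
rewrite normrM ger0_norm ?invr_ge0; last lra.
have e0 : 0 <= e by rewrite exprn_ge0.
have : (2 * c)^-1 <= 1 by rewrite invf_le1; lra.
have : 0 <= (2 * c)^-1 by rewrite invr_ge0; lra.
have := ler_normB u v; set w := (2 * c)^-1 => uv w0 w1.
apply: (@le_trans _ _ (1 * (`|u| + `|v|))); first exact: ler_pM.
by nra.
Qed.

Lemma dd_pow m a : size s = m.+2 -> (a <= m)%N ->
  `|dd s (fun x => x ^+ a * g x)| <= 2 ^+ (m - a) * dd s (fun x => x ^+ m * g x).
Proof.
move=> sm am; have := @dd_pow_outer [::] m a sm isT (fun _ => ltac:(by [])) am.
have E e : dd s (fun x => (\prod_(y <- [::]) (x - y)) * x ^+ e * g x) =
    dd s (fun x => x ^+ e * g x).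
  by apply: eq_dd => x _; rewrite big_nil mul1r.
by rewrite !E.
Qed.

End LoewnerCondition.

Lemma dd_pair (R : realFieldType) (g : R -> R) (a b : R) : a != b ->
  dd [:: a; b] g = (g b - g a) / (b - a).
Proof.
move=> ab; rewrite /dd /node_prod !big_cons !big_nil !eqxx /= ab eq_sym ab !mulr1 addr0.
by field; rewrite !subr_eq0 ab eq_sym ab.
Qed.

(** Dropping the node [c] amounts to multiplying by [x - c], and there the term
    [c * x ^ m] is at most half of [x ^ m.+1] by [dd_pow], since [`|c| <= 1/4]. *)
Lemma dd_top_pow_le (R : realFieldType) (g : R -> R) (m : nat) (s : seq R) (a b : R) : loewner g ->
  size s = m -> uniq (s ++ [:: a; b]) -> {in s ++ [:: a; b], forall x, `|x| <= 4^-1} ->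
  dd (s ++ [:: a; b]) (fun x => x ^+ m * g x) <= 2 ^+ m * dd [:: a; b] g.
Proof.
move=> gL; elim: s m => [|c s IHs] [|m] //= sm.
  by move=> _ _; rewrite mul1r (eq_dd (h := g)) // => x _; rewrite mul1r.
case: sm => sm ucs cs4.
have [cns us] := andP ucs.
have IH := IHs m sm us (fun x xs => cs4 x (mem_behead (s := c :: _) xs)).
have := dd_pow gL (s := c :: s ++ [:: a; b]) ucs cs4 (m := m.+1) (a := m).
rewrite /= size_cat /= addn2 sm subSnn expr1 => /(_ erefl (leqnSn m)).
have := dd_pow gL (s := c :: s ++ [:: a; b]) ucs cs4 (m := m.+1) (a := m.+1).
rewrite /= size_cat /= addn2 sm subnn expr0 mul1r => /(_ erefl (leqnn _)).
move=> /(le_trans (normr_ge0 _)).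
have c4 : `|c| <= 4^-1 by apply: cs4; rewrite inE eqxx.
move: IH; rewrite -(dd_consM _ cns).
rewrite (eq_dd (h := fun x => x ^+ m.+1 * g x - c * (x ^+ m * g x))); last first.
  by move=> x _; rewrite exprS; ring.
rewrite ddB ddZ.
set X := dd _ _; set Y := dd _ _; set B := dd _ _ => IH X0 YX.
rewrite exprS; have : `|c * Y| <= 4^-1 * (2 * X).
  by rewrite normrM ler_pM.
by rewrite ler_norml; move: IH; set T := _ ^+ m * B; rewrite -mulrA -/T; lra.
Qed.

(** For [y = -1/2] and [y = 1/2] the function [(x - y) * g x] has nonnegative
    second divided differences, so that its slopes are controlled by slopes to the
    far points [3/4] and [-3/4]; the difference of the two functions is [g]. *)
Lemma dd_pair_bound (R : realFieldType) (g : R -> R) (M a b : R) : loewner g ->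
  (forall x, `|x| <= 1 -> `|g x| <= M) -> a != b -> `|a| <= 4^-1 -> `|b| <= 4^-1 ->
  dd [:: a; b] g <= 12 * M.
Proof.
move=> gL gM ab a4 b4.
have M0 : 0 <= M by rewrite (le_trans (normr_ge0 (g 0))) // gM // normr0.
pose G (y x : R) : R := (x - y) * g x.
have G3 (y p q r : R) : `|y| = 2^-1 -> uniq [:: p; q; r] ->
   {in [:: p; q; r], forall x, `|x| <= 1 /\ `|x| != 2^-1} -> p < r ->
   dd [:: p; q] (G y) <= dd [:: r; q] (G y).
  move=> y2 upqr pqr1 pr.
  have upqr' : uniq [:: p; r; q] by rewrite (perm_uniq (s2 := [:: p; q; r])) // perm_cons;
    exact: permEl (perm_catC [:: r] [:: q]).
  have := dd_rec (G y) upqr'.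
  have : 0 <= dd [:: p; r; q] (G y).
    have := @dd_prod_ge0 _ _ gL [:: p; r; q] [:: y].
    rewrite (eq_dd (h := G y)); last by move=> x _; rewrite big_seq1.
    apply => //.
      rewrite cat1s cons_uniq upqr' andbT; apply/negP => yin.
      have /pqr1[_] : y \in [:: p; q; r] by move: yin; rewrite !inE => /or3P[] ->; rewrite ?orbT.
      by rewrite y2 eqxx.
    move=> x; rewrite cat1s inE => /orP[/eqP ->|xin]; first by rewrite y2; lra.
    by have /pqr1[] : x \in [:: p; q; r] by move: xin; rewrite !inE => /or3P[] ->; rewrite ?orbT.
  by nra.
have GM (y x : R) : `|y| = 2^-1 -> `|x| <= 1 -> `|G y x| <= 3 / 2 * M.
  move=> y2 x1; rewrite normrM; apply: ler_pM => //; last exact: gM.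
  by rewrite (le_trans (ler_normB _ _)) // y2; lra.
have D6 (y r q : R) : `|y| = 2^-1 -> r != q -> 2^-1 <= `|r - q| -> `|r| <= 1 -> `|q| <= 1 ->
    `|dd [:: r; q] (G y)| <= 6 * M.
  move=> y2 rq rq2 r1 q1; rewrite dd_pair // normrM normfV distrC.
  have -> : 6 * M = (3 / 2 * M + 3 / 2 * M) * (2^-1)^-1 by field.
  apply: ler_pM; rewrite ?invr_ge0 //.
    by rewrite (le_trans (ler_normB _ _)) // lerD // GM.
  by rewrite distrC lef_pV2 // posrE; lra.
have -> : dd [:: a; b] g = dd [:: a; b] (G (- 2^-1)) - dd [:: a; b] (G 2^-1).
  by rewrite -ddB; apply: eq_dd => x _; rewrite /G; field.
have p2 : `|2^-1 : R| = 2^-1 by rewrite ger0_norm ?invr_ge0 // ler0n.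
have n2 : `|- 2^-1 : R| = 2^-1 by rewrite normrN.
have := a4; rewrite ler_norml => /andP[a1 a2].
have := b4; rewrite ler_norml => /andP[b1 b2].
have far (x : R) : `|x| <= 4^-1 -> `|x| <= 1 /\ `|x| != 2^-1.
  by move=> x4; split; [|apply/eqP => xE; move: x4; rewrite xE]; lra.
have q1 : `|3 / 4 : R| = 3 / 4 by rewrite ger0_norm //; lra.
have qn : `|- (3 / 4) : R| = 3 / 4 by rewrite normrN.
have [qf1 qf2] : 3 / 4 <= 1 :> R /\ 3 / 4 != 2^-1 :> R by split; [|apply/eqP]; lra.
have right_ge : dd [:: a; b] (G (- 2^-1)) <= dd [:: 3 / 4; b] (G (- 2^-1)).
  apply: G3; rewrite // ?inE.
  - by rewrite /= !inE negb_or ab /= andbT; apply/andP; split; apply/eqP; lra.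
  - by move=> x; rewrite !inE => /or3P[] /eqP ->; rewrite ?q1; [exact: far|exact: far|].
  - by lra.
have left_le : dd [:: - (3 / 4); a] (G 2^-1) <= dd [:: b; a] (G 2^-1).
  apply: G3; rewrite // ?inE.
  - by rewrite /= !inE negb_or ab /= andbT; apply/andP; split; apply/eqP; lra.
  - by move=> x; rewrite !inE => /or3P[] /eqP ->; rewrite ?qn; [|exact: far|exact: far].
  - by lra.
have /ler_normlP[_ D1] : `|dd [:: 3 / 4; b] (G (- 2^-1))| <= 6 * M.
  by apply: D6; rewrite ?q1 //; [apply/eqP; lra|rewrite ger0_norm; lra|lra].
have /ler_normlP[D2 _] : `|dd [:: - (3 / 4); a] (G 2^-1)| <= 6 * M.
  by apply: D6; rewrite ?qn //; [apply/eqP; lra|rewrite ler0_norm; lra|lra].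
rewrite (perm_dd _ (s1 := [:: b; a]) (s2 := [:: a; b])) in left_le; first lra.
exact: permEl (perm_catC [:: b] [:: a]).
Qed.

(** A factor [2 ^ m] comes from trading [1] for [x ^ m], another one from
    removing [m] nodes to reach a difference quotient. *)
Lemma loewner_dd_bound (R : realFieldType) (g : R -> R) (M : R) m s : loewner g ->
  (forall x, `|x| <= 1 -> `|g x| <= M) -> uniq s -> size s = m.+2 ->
  {in s, forall x, `|x| <= 4^-1} -> `|dd s g| <= 12 * M * 4 ^+ m.
Proof.
move=> gL gM us sm s4; have := dd_pow gL us s4 sm (leq0n m).
rewrite (eq_dd (h := g)) => [|x _]; last by rewrite mul1r.
move=> /le_trans; apply; rewrite subn0.
have -> : 4 ^+ m = 2 ^+ m * 2 ^+ m :> R by rewrite -exprMn -natrM.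
rewrite mulrCA ler_wpM2l ?exprn_ge0 //.
move: us sm s4; case/lastP: s => // s b; case/lastP: s => // s a.
rewrite -cats1 -cats1 -catA => us; rewrite size_cat addn2 => -[sm] s4.
have := dd_top_pow_le gL sm us s4; move/le_trans; apply; rewrite mulrC ler_wpM2r ?exprn_ge0 //.
apply: dd_pair_bound => //.
- by move: us; rewrite cat_uniq /= inE => /and3P[_ _ /andP[]].
- by apply: s4; rewrite mem_cat !inE eqxx orbT.
- by apply: s4; rewrite mem_cat !inE eqxx !orbT.
Qed.

(** * Positive semidefinite matrices *)

Section Psd.
Local Open Scope sesquilinear_scope.
Local Open Scope complex_scope.
Variable R : realType.
Local Notation C := R[i].

Lemma adjmxM m n p (A : 'M[C]_(m, n)) (B : 'M[C]_(n, p)) :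
  (A *m B) ^t* = B ^t* *m A ^t*.
Proof. by rewrite trmx_mul map_mxM. Qed.

Lemma hermsymmxP n (A : 'M[C]_n) : reflect (A ^t* = A) (A \is hermsymmx).
Proof.
by apply: (iffP (is_hermitianmxP _ _ _)); rewrite expr0 scale1r => /esym.
Qed.

Lemma psdmx_gram m n (B : 'M[C]_(n, m)) : psdmx (B *m B ^t*).
Proof.
split; first by apply/hermsymmxP; rewrite adjmxM trmxCK.
move=> v; rewrite mulmxA -mulmxA -[X in _ *m X]trmxCK adjmxM trmxCK.
rewrite mxE; apply: sumr_ge0 => j _.
by rewrite [in X in _ * X]mxE [in X in _ * X]mxE mul_conjC_ge0.
Qed.

Lemma psdmxD n (A B : 'M[C]_n) : psdmx A -> psdmx B -> psdmx (A + B).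
Proof.
move=> [/hermsymmxP hA pA] [/hermsymmxP hB pB]; split.
  by apply/hermsymmxP; rewrite linearD map_mxD /= hA hB.
by move=> v; rewrite mulmxDr mulmxDl mxE addr_ge0.
Qed.

Lemma psdmxZ n (c : R) (A : 'M[C]_n) : 0 <= c -> psdmx A -> psdmx (c%:C *: A).
Proof.
move=> c0 [/hermsymmxP hA pA]; split.
  apply/hermsymmxP; rewrite linearZ map_mxZ /= hA; congr (_ *: _).
  exact: conjc_real.
by move=> v; rewrite -scalemxAr -scalemxAl mxE mulr_ge0 // ler0c.
Qed.

Lemma psdmx_conj_diag n (U : 'M[C]_n) (c : 'I_n -> R) : (forall j, 0 <= c j) ->
  psdmx (U *m diag_mx (\row_j (c j)%:C) *m U ^t*).
Proof.
move=> c0; pose D : 'M[C]_n := diag_mx (\row_j (Num.sqrt (c j))%:C).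
have -> : U *m diag_mx (\row_j (c j)%:C) *m U ^t* = (U *m D) *m (U *m D) ^t*.
  rewrite adjmxM !mulmxA -[in RHS](mulmxA U); congr (_ *m _ *m _).
  have -> : D ^t* = D.
    apply/matrixP => i j; rewrite !mxE; case: eqP => [->|ne].
      by rewrite eqxx !mulr1n; exact: conjc_real.
    by rewrite eq_sym (introF eqP ne) !mulr0n rmorph0.
  apply/matrixP => i j; rewrite /D mulmx_diag !mxE -rmorphM /=.
  by rewrite -expr2 sqr_sqrtr.
exact: psdmx_gram.
Qed.

Lemma unitarymx_adjK n (U : 'M[C]_n) : U \is unitarymx -> U ^t* *m U = 1%:M.
Proof.
by move=> uU; move: (uU); rewrite -trmxC_unitary => /unitarymxP; rewrite trmxCK.
Qed.

Lemma contraction_diag n (U : 'M[C]_n) (c : 'I_n -> R) : U \is unitarymx ->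
  (forall j, `|c j| <= 1) ->
  let A := U *m diag_mx (\row_j (c j)%:C) *m U ^t* in
  psdmx (1%:M - A) /\ psdmx (1%:M + A).
Proof.
move=> /unitarymxP UU c1.
have E (e : R) : 1%:M + e%:C *: (U *m diag_mx (\row_j (c j)%:C) *m U ^t*) =
    U *m diag_mx (\row_j (1 + e * c j)%:C) *m U ^t*.
  have -> : diag_mx (\row_j (1 + e * c j)%:C) =
      1%:M + e%:C *: diag_mx (\row_j (c j)%:C) :> 'M[C]_n.
    apply/matrixP => i j; rewrite !mxE; case: eqP => _; rewrite ?mulr1n ?mulr0n.
      by rewrite rmorphD rmorphM rmorph1.
    by rewrite mulr0 addr0.
  by rewrite mulmxDr mulmxDl mulmx1 UU -scalemxAr -scalemxAl.
split.
  have := E (-1); rewrite rmorphN rmorph1 scaleN1r => ->; apply: psdmx_conj_diag => j.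
  by have := c1 j; rewrite ler_norml; lra.
have := E 1; rewrite rmorph1 scale1r => ->; apply: psdmx_conj_diag => j.
by have := c1 j; rewrite ler_norml; lra.
Qed.

(** The joint spectrum along a segment of matrices is controlled through this
    converse of [contraction_diag], whose hypotheses are convex in [A]. *)
Lemma contraction_spectrum n (A : 'M[C]_n) : A \is hermsymmx ->
  psdmx (1%:M - A) -> psdmx (1%:M + A) ->
  exists U (c : 'I_n -> R), [/\ U \is unitarymx,
    A = U *m diag_mx (\row_j (c j)%:C) *m U ^t* & forall j, `|c j| <= 1].
Proof.
move=> hA [_ p1] [_ p2]; pose U := (spectralmx A) ^t*; pose D := spectral_diag A.
have uU : U \is unitarymx by rewrite trmxC_unitary spectral_unitarymx.
have AE : A = U *m diag_mx D *m U ^t*.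
  have /orthomx_spectralP := hermitian_normalmx hA.
  by rewrite invmx_unitary ?spectral_unitarymx // trmxCK.
have UU := unitarymx_adjK uU.
pose c j := complex.Re (D 0 j).
have DE : D = \row_j (c j)%:C.
  apply/rowP => j; rewrite mxE /c RRe_real //.
  by have /mxOverP := hermitian_spectral_diag_real hA; apply.
have UAU (e : C) : U ^t* *m (1%:M + e *: A) *m U = 1%:M + e *: diag_mx D.
  rewrite mulmxDr mulmxDl mulmx1 UU -scalemxAr -scalemxAl AE !mulmxA UU mul1mx.
  by rewrite -mulmxA UU mulmx1.
pose v j : 'cV_n := U *m delta_mx j 0.
have De (e : R) j :
    ((v j) ^t* *m (1%:M + e%:C *: A) *m v j) 0 0 = (1 + e * c j)%:C.
  rewrite adjmxM; set w : 'cV_n := delta_mx j 0.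
  have -> : w ^t* *m U ^t* *m (1%:M + e%:C *: A) *m (U *m w)
    = w ^t* *m (U ^t* *m (1%:M + e%:C *: A) *m U) *m w by rewrite !mulmxA.
  rewrite UAU trmx_delta map_delta_mx -rowE -colE !mxE eqxx !mulr1n DE mxE.
  by rewrite rmorphD rmorphM rmorph1.
exists U, c; split; [exact: uU | by rewrite -DE | move=> j].
have := p1 (v j); rewrite -[- A]scaleN1r -(rmorph1 (real_complex R)) -rmorphN De ler0c.
have := p2 (v j); rewrite -[A]scale1r -[in X in X *: A](rmorph1 (real_complex R)) De ler0c.
by rewrite ler_norml => ? ?; apply/andP; split; lra.
Qed.

End Psd.

(** * Loewner's condition along coordinate lines *)

Section MonotoneAlongLines.
Local Open Scope sesquilinear_scope.
Local Open Scope complex_scope.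
Variable R : realType.
Local Notation C := R[i].

Lemma C1_with_affine (a b : R) : C1_with (fun t => a + t * b) (fun=> b).
Proof.
split; first by apply: continuous_subspaceT => x; exact: cvg_cst.
move=> t _; apply: cvg_within_filter; apply: cvg_near_cst.
near=> s; have st : s - t != 0.
  by rewrite subr_eq0; near: s; exact: nbhs_dnbhs_neq.
by rewrite opprD addrACA subrr add0r -mulrBl mulrAC mulfV // mul1r.
Unshelve. all: by end_near.
Qed.

(** A straight segment is a C^1 curve with constant derivative [B - A]. *)
Lemma fcalc_le_segment d n (E : set 'rV[R]_d) f (A B : 'I_d -> 'M[C]_n) :
  (0 < n)%N -> locally_matrix_monotone E f ->
  (forall i, psdmx (B i - A i)) ->
  (forall t : R, 0 <= t <= 1 -> csam E (fun i => A i + t%:C *: (B i - A i))) ->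
  loewner_le (fcalc f A) (fcalc f B).
Proof.
move=> n0 fmon AB EAB.
pose gam (t : R) i := A i + t%:C *: (B i - A i).
have g0 : gam 0 = A by apply/funext => i; rewrite /gam rmorph0 scale0r addr0.
have g1 : gam 1 = B by apply/funext => i; rewrite /gam rmorph1 scale1r addrC subrK.
rewrite -g0 -g1; apply: (fmon n n0 gam (fun=> fun i => B i - A i)).
- move=> i k l; split.
    have -> : (fun t => complex.Re (gam t i k l)) =
        fun t => complex.Re (A i k l) + t * complex.Re ((B i - A i) k l).
      apply/funext => t; rewrite /gam 2!mxE.
      by case: (A i k l) => a b; case: ((B i - A i) k l) => u v /=; rewrite mul0r subr0.
    exact: C1_with_affine.
  have -> : (fun t => complex.Im (gam t i k l)) =
      fun t => complex.Im (A i k l) + t * complex.Im ((B i - A i) k l).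
    apply/funext => t; rewrite /gam 2!mxE.
    by case: (A i k l) => a b; case: ((B i - A i) k l) => u v /=; rewrite mul0r addr0.
  exact: C1_with_affine.
- by move=> t; rewrite in_itv /=; exact: EAB.
- by [].
- by rewrite in_itv /= lexx ler01.
- by rewrite in_itv /= lexx ler01.
- exact: ler01.
Qed.

Lemma diag_const n (c : R) : diag_mx (\row__ c%:C) = c%:C%:M :> 'M[C]_n.
Proof. by apply/matrixP => i j; rewrite !mxE. Qed.

Definition upd d (x : 'rV[R]_d) (i : 'I_d) (s : R) : 'rV[R]_d :=
  \row_k (if k == i then s else x 0 k).

Lemma real_scalar_hermsymmx n (c : R) : (c%:C%:M : 'M[C]_n) \is hermsymmx.
Proof.
apply/hermsymmxP; rewrite tr_scalar_mx map_scalar_mx; congr (_%:M).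
exact: conjc_real.
Qed.

Lemma diag_hermsymmx n (U : 'M[C]_n) (c : 'I_n -> R) :
  U *m diag_mx (\row_j (c j)%:C) *m U ^t* \is hermsymmx.
Proof.
apply/hermsymmxP; rewrite !adjmxM trmxCK mulmxA tr_diag_mx map_diag_mx.
have -> : map_mx Num.conj (\row_j (c j)%:C) = \row_j (c j)%:C :> 'rV[C]_n; last by [].
by apply/rowP => j; rewrite !mxE; exact: conjc_real.
Qed.

Lemma hermsymmxD n (A B : 'M[C]_n) :
  A \is hermsymmx -> B \is hermsymmx -> A + B \is hermsymmx.
Proof.
by move=> /hermsymmxP hA /hermsymmxP hB; apply/hermsymmxP; rewrite linearD map_mxD /= hA hB.
Qed.

Lemma hermsymmxZ n (c : R) (A : 'M[C]_n) : A \is hermsymmx -> c%:C *: A \is hermsymmx.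
Proof.
move=> /hermsymmxP hA; apply/hermsymmxP; rewrite linearZ map_mxZ /= hA.
by congr (_ *: _); exact: conjc_real.
Qed.

(** The tuples through which a condition on several commuting matrices speaks of
    one variable: all entries but one are scalar matrices, hence they commute. *)
Definition on_coord d n (x : 'rV[R]_d) (i : 'I_d) (H : 'M[C]_n) k : 'M[C]_n :=
  if k == i then H else (x 0 k)%:C%:M.

Lemma joint_diag_coord d n (x : 'rV[R]_d) (i : 'I_d) (U : 'M[C]_n) (c : 'I_n -> R) :
  U \is unitarymx ->
  joint_diag (on_coord x i (U *m diag_mx (\row_j (c j)%:C) *m U ^t*)) U
    (fun j => upd x i (c j)).
Proof.
move=> uU; split => // k; rewrite /on_coord.
have [->|ki] := eqVneq k i.
  by congr (_ *m diag_mx _ *m _); apply/rowP => j; rewrite !mxE eqxx.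
have -> : \row_j (upd x i (c j) 0 k)%:C = \row__ (x 0 k)%:C :> 'rV[C]_n.
  by apply/rowP => j; rewrite !mxE (negbTE ki).
rewrite diag_const scalar_mxC -mulmxA; have /unitarymxP -> := uU.
by rewrite mulmx1.
Qed.

Lemma csam_coord d n (E : set 'rV[R]_d) (x : 'rV[R]_d) (i : 'I_d)
   (U : 'M[C]_n) (c : 'I_n -> R) :
  U \is unitarymx -> (forall j, E (upd x i (c j))) ->
  csam E (on_coord x i (U *m diag_mx (\row_j (c j)%:C) *m U ^t*)).
Proof.
move=> uU Ec; split.
- move=> k; rewrite /on_coord; case: eqP => _; first exact: diag_hermsymmx.
  exact: real_scalar_hermsymmx.
- by move=> k l; rewrite /on_coord; do 2 case: eqP => _ //; rewrite scalar_mxC.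
- by exists U, (fun j => upd x i (c j)); split => //; exact: joint_diag_coord.
Qed.

Lemma unitary_affine n (U : 'M[C]_n) (c : 'I_n -> R) (p r : R) : U \is unitarymx ->
  U *m diag_mx (\row_j (p + r * c j)%:C) *m U ^t* =
  p%:C%:M + r%:C *: (U *m diag_mx (\row_j (c j)%:C) *m U ^t*).
Proof.
move=> /unitarymxP UU.
have -> : diag_mx (\row_j (p + r * c j)%:C) =
    p%:C%:M + r%:C *: diag_mx (\row_j (c j)%:C) :> 'M[C]_n.
  apply/matrixP => i j; rewrite !mxE; case: eqP => _; rewrite ?mulr1n ?mulr0n.
    by rewrite rmorphD rmorphM.
  by rewrite mulr0 addr0.
by rewrite mulmxDr mulmxDl scalar_mxC -[X in X + _]mulmxA UU mulmx1 -scalemxAr -scalemxAl.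
Qed.

Definition complexmx m n (X : 'M[R]_(m, n)) : 'M[C]_(m, n) :=
  map_mx (real_complex R) X.

Lemma complexmx_adj m n (X : 'M[R]_(m, n)) : (complexmx X) ^t* = complexmx X^T.
Proof. by apply/matrixP => a b; rewrite !mxE; exact: conjc_real. Qed.

Lemma complexmx_diag n (a : 'I_n -> R) :
  complexmx (diag_mx (\row_j a j)) = diag_mx (\row_j (a j)%:C).
Proof.
by rewrite /complexmx map_diag_mx; congr diag_mx; apply/rowP => j; rewrite !mxE.
Qed.

Definition udiag n (U : 'M[C]_n) (c : 'I_n -> R) : 'M[C]_n :=
  U *m diag_mx (\row_j (c j)%:C) *m U ^t*.

Lemma affine_segment (V : lmodType C) (p a b : V) (r t : C) :
  (p + r *: a) + t *: ((p + r *: b) - (p + r *: a)) =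
  p + r *: ((1 - t) *: a + t *: b).
Proof.
rewrite opprD addrACA subrr add0r -scalerBr -addrA; congr (_ + _).
rewrite scalerA mulrC -scalerA -scalerDr; congr (_ *: _).
by rewrite scalerBr scalerBl scale1r addrA addrAC.
Qed.

Lemma convex_contraction n (A B : 'M[C]_n) (t : R) : 0 <= t <= 1 ->
  psdmx (1%:M - A) -> psdmx (1%:M - B) ->
  psdmx (1%:M - ((1 - t)%:C *: A + t%:C *: B)).
Proof.
move=> /andP[t0 t1] pA pB.
have tC : (1 - t)%:C + t%:C = 1 :> C by rewrite -rmorphD subrK rmorph1.
have -> : 1%:M - ((1 - t)%:C *: A + t%:C *: B) =
    (1 - t)%:C *: (1%:M - A) + t%:C *: (1%:M - B).
  by rewrite !scalerBr addrACA -scalerDl tC scale1r -opprD.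
have t0' : 0 <= 1 - t by rewrite subr_ge0.
exact: psdmxD (psdmxZ t0' pA) (psdmxZ t0 pB).
Qed.

Lemma fcalc_le_on_coord d n (E : set 'rV[R]_d) f (x : 'rV[R]_d) (i : 'I_d) (r : R)
    (A B : 'M[C]_n) :
  (0 < n)%N -> locally_matrix_monotone E f -> 0 < r ->
  (forall t, `|t| <= 1 -> E (upd x i (x 0 i + r * t))) ->
  A \is hermsymmx -> B \is hermsymmx ->
  psdmx (1%:M - A) -> psdmx (1%:M + A) -> psdmx (1%:M - B) -> psdmx (1%:M + B) ->
  psdmx (B - A) ->
  loewner_le (fcalc f (on_coord x i ((x 0 i)%:C%:M + r%:C *: A)))
             (fcalc f (on_coord x i ((x 0 i)%:C%:M + r%:C *: B))).
Proof.
move=> n0 fmon r0 Ex hA hB a1 a2 b1 b2 BA.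
apply: (fcalc_le_segment n0 fmon); first move=> k.
  rewrite /on_coord; case: eqP => _.
    rewrite opprD addrACA subrr add0r -scalerBr.
    by apply: psdmxZ; [exact: ltW | exact: BA].
  by rewrite subrr; have := psdmx_gram (0 : 'M[C]_(n, n)); rewrite mul0mx.
move=> t t01; pose H := (1 - t)%:C *: A + t%:C *: B.
have hH : H \is hermsymmx by apply: hermsymmxD; exact: hermsymmxZ.
have H1 : psdmx (1%:M - H) by exact: convex_contraction.
have H2 : psdmx (1%:M + H).
  have -> : 1%:M + H = 1%:M - ((1 - t)%:C *: (- A) + t%:C *: (- B)).
    by rewrite !scalerN -opprD opprK.
  by apply: (convex_contraction t01); rewrite opprK.
have [W [c [uW HE c1]]] := contraction_spectrum hH H1 H2.
have -> : (fun k => on_coord x i ((x 0 i)%:C%:M + r%:C *: A) k + t%:C *: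
   (on_coord x i ((x 0 i)%:C%:M + r%:C *: B) k
    - on_coord x i ((x 0 i)%:C%:M + r%:C *: A) k)) =
    on_coord x i (W *m diag_mx (\row_j (x 0 i + r * c j)%:C) *m W ^t*).
  apply/funext => k; rewrite /on_coord; case: eqP => _; last by rewrite subrr scaler0 addr0.
  rewrite (unitary_affine c (x 0 i) r uW) -[X in _ = _ + _ *: X]HE.
  by rewrite affine_segment /H rmorphB rmorph1.
by apply: csam_coord => // j; exact: Ex.
Qed.

Lemma udiag_le_on_coord d n (E : set 'rV[R]_d) f (x : 'rV[R]_d) (i : 'I_d) (r : R)
    (U V : 'M[C]_n) (lam mu : 'I_n -> R) :
  (0 < n)%N -> locally_matrix_monotone E f -> 0 < r ->
  (forall t, `|t| <= 1 -> E (upd x i (x 0 i + r * t))) ->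
  U \is unitarymx -> V \is unitarymx ->
  (forall j, `|lam j| <= 1) -> (forall j, `|mu j| <= 1) ->
  psdmx (udiag V mu - udiag U lam) ->
  loewner_le (udiag U (fun j => f (upd x i (x 0 i + r * lam j))))
             (udiag V (fun j => f (upd x i (x 0 i + r * mu j)))).
Proof.
move=> n0 fmon r0 Ex uU uV lam1 mu1 BA.
have fE W (c : 'I_n -> R) : W \is unitarymx ->
    fcalc f (on_coord x i ((x 0 i)%:C%:M + r%:C *: udiag W c)) =
    udiag W (fun j => f (upd x i (x 0 i + r * c j))).
  move=> uW; rewrite -(unitary_affine c (x 0 i) r uW).
  exact: (fcalcE f (joint_diag_coord x i _ uW)).
have [a1 a2] := contraction_diag uU lam1; have [b1 b2] := contraction_diag uV mu1.
rewrite -(fE _ _ uU) -(fE _ _ uV).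
exact: (fcalc_le_on_coord n0 fmon r0 Ex (diag_hermsymmx _ _) (diag_hermsymmx _ _) a1 a2 b1 b2 BA).
Qed.

(** The interlacing pair of matrices attached to the nodes has its spectrum in
    [-1, 1], so the segment between its members stays within the spectral
    constraint, and [v] extracts the divided difference from [f(A) <= f(B)]. *)
Lemma locally_matrix_monotone_loewner d (E : set 'rV[R]_d) f (x : 'rV[R]_d) (i : 'I_d) (r : R) :
  locally_matrix_monotone E f -> 0 < r ->
  (forall t, `|t| <= 1 -> E (upd x i (x 0 i + r * t))) ->
  loewner (fun t => f (upd x i (x 0 i + r * t))).
Proof.
move=> fmon r0 Ex [|n] s h us sn hn s1.
  by case: s sn {us s1} => // _; rewrite /dd big_nil.
have [mu [lam [Q [u [mem QQ rk1 /(_ h hn) [v ddE]]]]]] := interlacing_pair (ltn0Sn n) us sn.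
have uU : complexmx Q^T \is unitarymx.
  by apply/unitarymxP; rewrite complexmx_adj trmxK -map_mxM QQ map_mx1.
have u1 : (1%:M : 'M[C]_n.+1) \is unitarymx by apply/unitarymxP; rewrite trmx1 map_mx1 mulmx1.
have fE g : udiag (complexmx Q^T) (fun j => g (mu j)) - udiag 1%:M (fun j => g (lam j))
    = complexmx (Q^T *m diag_mx (\row_j g (mu j)) *m Q - diag_mx (\row_j g (lam j))).
  rewrite /udiag trmx1 map_mx1 mul1mx mulmx1 complexmx_adj trmxK -!complexmx_diag.
  by rewrite /complexmx map_mxB !map_mxM.
have mu1 j : `|mu j| <= 1 by apply: s1; case: (mem j).
have lam1 j : `|lam j| <= 1 by apply: s1; case: (mem j).
have BA : psdmx (udiag (complexmx Q^T) mu - udiag 1%:M lam).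
  have -> : udiag (complexmx Q^T) mu - udiag 1%:M lam = complexmx u *m (complexmx u) ^t*.
    by rewrite (fE id) rk1 complexmx_adj /complexmx map_mxM.
  exact: psdmx_gram.
have [_ /(_ (complexmx v))] := udiag_le_on_coord (ltn0Sn n) fmon r0 Ex u1 uU lam1 mu1 BA.
rewrite (fE (fun t => f (upd x i (x 0 i + r * t)))).
rewrite complexmx_adj -!map_mxM [X in 0 <= X]mxE ler0c.
by rewrite (ddE (fun t => f (upd x i (x 0 i + r * t)))).
Qed.

(** The case of matrices of size [1], along the segment from [x] to [y]. *)
Lemma locally_matrix_monotone_le d (E : set 'rV[R]_d) f (x y : 'rV[R]_d) :
  locally_matrix_monotone E f -> (forall i, x 0 i <= y 0 i) ->
  (forall t : R, 0 <= t <= 1 -> E (x + t *: (y - x))) -> f x <= f y.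
Proof.
move=> fmon xy Exy.
pose A (z : 'rV[R]_d) (i : 'I_d) : 'M[C]_1 := (z 0 i)%:C%:M.
have u1 : (1%:M : 'M[C]_1) \is unitarymx by apply/unitarymxP; rewrite trmx1 map_mx1 mulmx1.
have jd z : joint_diag (A z) 1%:M (fun=> z).
  by split => // i; rewrite mul1mx trmx1 map_mx1 mulmx1 diag_const.
have := @fcalc_le_segment _ _ E f (A x) (A y) (ltn0Sn 0) fmon.
case.
- move=> i.
  have -> : A y i - A x i = 1%:M *m diag_mx (\row__ (y 0 i - x 0 i)%:C) *m (1%:M : 'M[C]_1) ^t*.
    by rewrite mul1mx trmx1 map_mx1 mulmx1 diag_const /A rmorphB raddfB.
  by apply: psdmx_conj_diag => j; rewrite subr_ge0.
- move=> t t01; have -> : (fun i => A x i + t%:C *: (A y i - A x i)) = A (x + t *: (y - x)).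
    apply/funext => i; apply/matrixP => a b; rewrite !ord1 !mxE eqxx !mulr1n.
    by rewrite rmorphD rmorphM rmorphB.
  split; first by move=> i; exact: real_scalar_hermsymmx.
    by move=> i j; rewrite scalar_mxC.
  by exists 1%:M, (fun=> x + t *: (y - x)); split => // _; exact: Exy.
- rewrite !(fcalcE f (jd _)) => _ /(_ 1%:M).
  rewrite !(trmx1, map_mx1, mul1mx, mulmx1) !diag_const !mxE /= !mulr1n.
  by rewrite -rmorphB ler0c subr_ge0.
Qed.

End MonotoneAlongLines.

(** * Lagrange interpolation at equispaced nodes *)

Lemma bin_leq_exp2 n m : ('C(n, m) <= 2 ^ n)%N.
Proof.
elim: n m => [|n IHn] [|m] //; first by rewrite bin0 expn_gt0.
by rewrite binS expnS mul2n -addnn leq_add.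
Qed.

(** The integers at index [k] are the distances from [j] to the [n] other
    elements [lift j k] of [0..n]. *)
Lemma prod_gaps n j : (j <= n)%N ->
  (\prod_(k < n) (if k < j then j - k else k.+1 - j) = j`! * (n - j)`!)%N.
Proof.
move=> /subnKC <-; rewrite addKn; elim: (n - j)%N => [|p IHp].
  rewrite addn0 muln1; under eq_bigr do rewrite ltn_ord.
  elim: j => [|j IHj]; first by rewrite big_ord0.
  by rewrite big_ord_recl factS -IHj.
rewrite addnS big_ord_recr /= IHp ltnNge leq_addr /= -addnS addKn.
by rewrite factS -mulnA [(p`! * _)%N]mulnC.
Qed.

Section Interpolation.
Variables (R : realType) (delta : R).
Hypothesis delta0 : 0 < delta.

Definition node N (j : nat) : R := delta * j%:R / N.+1%:R.

Lemma node_inj N : injective (node N).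
Proof.
have N0 : N.+1%:R^-1 != 0 :> R by rewrite invr_eq0 pnatr_eq0.
move=> i j /(mulIf N0)/(mulfI (lt0r_neq0 delta0))/eqP.
by rewrite eqr_nat => /eqP.
Qed.

Lemma node_le N (j : 'I_N.+1) : `|node N j| <= delta.
Proof.
rewrite /node ger0_norm; last by rewrite divr_ge0 // mulr_ge0 // ltW.
by rewrite ler_pdivrMr ?ltr0n // ler_pM2l // ler_nat ltnW.
Qed.

Lemma prod_XsubC_bound (ts : seq R) : {in ts, forall t, `|t| <= delta} ->
  let p := \prod_(t <- ts) ('X - t%:P) in
  (forall k, `|p`_k| * delta ^+ k <= (2 * delta) ^+ size ts) /\
  (forall x, `|x| <= delta -> `|p.[x]| <= (2 * delta) ^+ size ts).
Proof.
move=> tsd /=; split=> [k|x xd].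
  elim: ts tsd k => [|t ts IHts] tsd k.
    by rewrite big_nil coef1; case: k => [|k]; rewrite /= ?normr1 ?expr0 ?mulr1 // normr0 mul0r ler01.
  have {}IHts := IHts (fun u uin => tsd u (mem_behead (s := t :: ts) uin)).
  have td : `|t| <= delta by apply: tsd; rewrite inE eqxx.
  rewrite big_cons mulrBl coefB coefXM coefCM /= exprS.
  set q := \prod_(_ <- ts) _ in IHts *.
  apply: (@le_trans _ _ (delta * (2 * delta) ^+ size ts + delta * (2 * delta) ^+ size ts)); last first.
    by set a := _ ^+ _; lra.
  have dk : 0 <= delta ^+ k by rewrite exprn_ge0 // ltW.
  apply: le_trans (ler_wpM2r dk (ler_normB _ _)) _; rewrite mulrDl lerD //.
    case: (k) => [|l] /=; first by rewrite normr0 mul0r mulr_ge0 ?exprn_ge0 ?mulr_ge0 // ltW.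
    by rewrite exprS mulrCA ler_wpM2l // ltW.
  by rewrite normrM -mulrA ler_pM // mulr_ge0 // exprn_ge0 // ltW.
rewrite horner_prod normr_prod; elim: ts tsd => [|t ts IHts] tsd; first by rewrite big_nil.
rewrite big_cons /= exprS ler_pM //; first by apply: prodr_ge0.
  rewrite hornerXsubC (le_trans (ler_normB _ _)) // mulr_natl mulr2n lerD //.
  by apply: tsd; rewrite inE eqxx.
by apply: IHts => u uin; apply: tsd; rewrite inE uin orbT.
Qed.

Definition ell N (j : 'I_N.+1) : {poly R} := tnth (lagrange N.+1 (node N)) j.

Lemma size_ell N (j : 'I_N.+1) : size (ell j) = N.+1.
Proof. by rewrite /ell size_lagrange_ //; exact: node_inj. Qed.

Lemma ell_node N (i j : 'I_N.+1) : (ell i).[node N j] = (i == j)%:R.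
Proof. by rewrite /ell lagrange_sample //; exact: node_inj. Qed.

Lemma ell_gen N (p : {poly R}) : (size p <= N.+1)%N ->
  p = \sum_(j < N.+1) p.[node N j]%:P * ell j.
Proof. by move=> pN; rewrite {1}(lagrange_gen (ltn0Sn N) (@node_inj N) pN). Qed.

Definition others N (j : 'I_N.+1) := [seq node N (nat_of_ord i) | i <- enum 'I_N.+1 & i != j].

Lemma prod_others (S : comNzRingType) N (j : 'I_N.+1) (G : R -> S) :
  \prod_(t <- others j) G t = \prod_(i < N.+1 | i != j) G (node N i).
Proof. by rewrite big_map big_filter big_enum_cond. Qed.

Lemma ellE N (j : 'I_N.+1) : let p := \prod_(t <- others j) ('X - t%:P) in
  ell j = (p.[node N j]^-1)%:P * p.
Proof.
rewrite /ell lagrangeE //=; last exact: node_inj.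
by rewrite prod_others.
Qed.

Lemma size_others N (j : 'I_N.+1) : size (others j) = N.
Proof.
have := etrans (count_predC (pred1 j) (enum 'I_N.+1)) (size_enum_ord _).
by rewrite /others size_map size_filter count_uniq_mem ?enum_uniq // mem_enum => -[].
Qed.

(** One factor [2] bounds the numerator of a Lagrange polynomial and one the
    binomial coefficients in its denominator; [expR 1] comes from
    [N.+1 ^ N / N!]. *)
Definition ell_bound : R := 4 * expR 1.

Lemma ell_bound_ge1 : 1 <= ell_bound.
Proof. by have := expR_ge1Dx (1 : R); rewrite /ell_bound; lra. Qed.

Lemma others_prodE N (j : 'I_N.+1) :
  `|\prod_(t <- others j) (node N j - t)| =
  (delta / N.+1%:R) ^+ N * (j`! * (N - j)`!)%:R.
Proof.
rewrite prod_others big_mkcond /=.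
rewrite (bigD1_ord j) //= eqxx mul1r -prod_gaps; last by rewrite -ltnS.
rewrite normr_prod natr_prod -[in X in _ ^+ X](card_ord N) -prodr_const -big_split /=.
apply: eq_bigr => k _; rewrite eq_sym neq_lift /node /= /bump.
have -> : delta * j%:R / N.+1%:R - delta * (((j <= k) + k)%N)%:R / N.+1%:R =
   delta / N.+1%:R * (j%:R - ((j <= k) + k)%N%:R) by ring.
rewrite normrM ger0_norm; last by rewrite divr_ge0 // ltW.
congr (_ * _); case: ltnP => kj; rewrite ?add0n ?add1n.
  by rewrite ger0_norm ?subr_ge0 ?ler_nat ?natrB // ltnW.
by rewrite ler0_norm ?subr_le0 ?ler_nat ?opprB ?natrB // leqW.
Qed.

(** With [N.+1] equispaced nodes the product of the gaps is within a geometric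
    factor of [delta ^+ N], because [N.+1 ^ N / N!] is a term of the exponential
    series of [N.+1] and the binomial coefficients are at most [2 ^ N]. *)
Lemma others_prod_ge N (j : 'I_N.+1) :
  (2 * delta) ^+ N <= ell_bound ^+ N.+1 * `|\prod_(t <- others j) (node N j - t)|.
Proof.
rewrite others_prodE; set D : R := (j`! * (N - j)`!)%:R.
have D0 : 0 <= D by [].
have ND : N`!%:R <= 2 ^+ N * D.
  by rewrite -natrX -natrM ler_nat -(bin_fact (m := j)) ?leq_mul2r ?bin_leq_exp2 ?orbT // -ltnS.
have NE : N.+1%:R ^+ N <= expR 1 ^+ N.+1 * N`!%:R :> R.
  have := expR_ge1Dxn N (ler0n R N.+1); rewrite -[in expR _](mulr1 N.+1%:R) expRM_natl.
  have -> : N.+1%:R ^+ N.+1 / N.+1`!%:R = N.+1%:R ^+ N / N`!%:R :> R.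
    by rewrite exprS factS natrM invfM mulrACA divff ?pnatr_eq0 // mul1r.
  have : 0 < N`!%:R :> R by rewrite ltr0n fact_gt0.
  move=> N0 h; rewrite -ler_pdivrMr //; lra.
have P0 : 0 < N.+1%:R ^+ N :> R by rewrite exprn_gt0 // ltr0n.
suff key : 2 ^+ N * N.+1%:R ^+ N <= ell_bound ^+ N.+1 * D.
  have -> : (2 * delta) ^+ N = 2 ^+ N * N.+1%:R ^+ N * (delta / N.+1%:R) ^+ N.
    by rewrite -!exprMn; congr (_ ^+ _); field; rewrite nat1r pnatr_eq0.
  by rewrite [leRHS]mulrCA [leRHS]mulrC ler_wpM2r // exprn_ge0 // divr_ge0 // ltW.
have e0 : 0 <= expR 1 ^+ N.+1 :> R by rewrite exprn_ge0 ?expR_ge0.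
apply: (@le_trans _ _ (2 ^+ N * (expR 1 ^+ N.+1 * (2 ^+ N * D)))).
  by rewrite ler_wpM2l ?exprn_ge0 //; apply: le_trans NE (ler_wpM2l e0 ND).
rewrite /ell_bound exprMn; have -> : 4 ^+ N.+1 = 4 * 2 ^+ N * 2 ^+ N :> R.
  by rewrite exprS -mulrA -exprMn -natrM.
have := mulr_ge0 e0 (mulr_ge0 (mulr_ge0 (exprn_ge0 N (ler0n R 2)) (exprn_ge0 N (ler0n R 2))) D0).
set a := 2 ^+ N; set b := expR 1 ^+ N.+1; lra.
Qed.

Lemma ell_bounds N (j : 'I_N.+1) :
  (forall k, `|(ell j)`_k| * delta ^+ k <= ell_bound ^+ N.+1) /\
  (forall x, `|x| <= delta -> `|(ell j).[x]| <= ell_bound ^+ N.+1).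
Proof.
have od : {in others j, forall t, `|t| <= delta} by move=> t /mapP[i _ ->]; exact: node_le.
have [cb hb] := prod_XsubC_bound od; have pj := others_prod_ge j.
rewrite ellE; set p := \prod_(_ <- _) _ in cb hb *.
have pE : p.[node N j] = \prod_(t <- others j) (node N j - t).
  by rewrite horner_prod; apply: eq_bigr => t _; rewrite hornerXsubC.
rewrite -pE in pj; rewrite size_others in cb hb.
have p0 : 0 < `|p.[node N j]|.
  rewrite normr_gt0; apply: contraTneq pj => ->.
  by rewrite normr0 mulr0 -ltNge exprn_gt0 // mulr_gt0.
have H z : z <= (2 * delta) ^+ N -> `|p.[node N j]|^-1 * z <= ell_bound ^+ N.+1.
  by move=> /le_trans/(_ pj) zp; rewrite mulrC ler_pdivrMr.
split => [k|x xd].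
  by rewrite coefCM normrM normfV -mulrA; exact: H.
by rewrite hornerCM normrM normfV; apply/H/hb.
Qed.

(** Off the nodes the error is the divided difference at the nodes and [x],
    multiplied by the product of the [x - node]. *)
Lemma interp1_error N (g : R -> R) (B : R) : 0 <= B ->
  (forall s, uniq s -> size s = N.+2 -> {in s, forall x, `|x| <= delta} -> `|dd s g| <= B) ->
  forall x, `|x| <= delta ->
    `|g x - \sum_(j < N.+1) g (node N j) * (ell j).[x]| <= B * (2 * delta) ^+ N.+1.
Proof.
move=> B0 gB x xd; pose ts := [seq node N (nat_of_ord i) | i <- enum 'I_N.+1].
have tsd : {in ts, forall t, `|t| <= delta} by move=> t /mapP[i _ ->]; exact: node_le.
have [/mapP[i _ ->]|xts] := boolP (x \in ts).
  rewrite (bigD1 i) //= ell_node eqxx mulr1 big1 ?addr0 ?subrr ?normr0 => [|j ji].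
    by rewrite mulr_ge0 // exprn_ge0 // mulr_ge0 // ltW.
  by rewrite ell_node (negbTE ji) mulr0.
have uts : uniq ts by rewrite map_inj_uniq ?enum_uniq // => i j /node_inj /val_inj.
have sts : size ts = N.+1 by rewrite size_map size_enum_ord.
have xs1 : {in x :: ts, forall y, `|y| <= delta}.
  by move=> y; rewrite inE => /orP[/eqP ->|/tsd].
have := gB (x :: ts); rewrite /= xts uts sts => /(_ isT erefl xs1) ddB.
pose w := \prod_(t <- ts) (x - t).
have <- : dd (x :: ts) g * w = g x - \sum_(j < N.+1) g (node N j) * (ell j).[x].
  have tsE (P : pred R) (G : R -> R) :
      \prod_(t <- ts | P t) G t = \prod_(i < N.+1 | P (node N i)) G (node N i).
    by rewrite big_map big_enum_cond.
  have xt (j : 'I_N.+1) : x - node N j != 0.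
    by rewrite subr_eq0; apply: contraNneq xts => ->; apply/mapP; exists j; rewrite ?mem_enum.
  have xbar : node_prod (x :: ts) x = w.
    rewrite /node_prod big_cons eqxx /= big_seq_cond [RHS]big_seq; apply: eq_bigl => t.
    by case: (boolP (t \in ts)) => //= tts; apply: contraNneq xts => <-.
  have tbar (j : 'I_N.+1) : node_prod (x :: ts) (node N j) =
      (node N j - x) * \prod_(t <- others j) (node N j - t).
    have -> : node_prod (x :: ts) (node N j) = (node N j - x) * node_prod ts (node N j).
      by rewrite /node_prod big_cons -subr_eq0 xt.
    congr (_ * _); rewrite /node_prod tsE prod_others.
    by apply: eq_bigl => i; rewrite /= (inj_eq (@node_inj N)).
  have wE (j : 'I_N.+1) : w = (x - node N j) * \prod_(t <- others j) (x - t).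
    by rewrite /w tsE prod_others (bigD1 j).
  have w0 : w != 0 by rewrite -xbar node_prod_neq0.
  rewrite /dd big_cons xbar mulrDl divfK //; congr (_ + _).
  rewrite big_map big_enum /= mulr_suml -sumrN; apply: eq_bigr => j _.
  have p0 : \prod_(t <- others j) (node N j - t) != 0.
    apply: contraTneq (others_prod_ge j) => ->.
    by rewrite normr0 mulr0 -ltNge exprn_gt0 // mulr_gt0.
  have hp y : (\prod_(t <- others j) ('X - t%:P)).[y] = \prod_(t <- others j) (y - t).
    by rewrite horner_prod; apply: eq_bigr => t _; rewrite hornerXsubC.
  rewrite tbar ellE hornerCM !hp (wE j).
  set u := \prod_(t <- _) (x - t); have := xt j; have : node N j - x != 0 by rewrite -opprB oppr_eq0.
  by move=> h1 h2; field; rewrite h1 p0.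
rewrite normrM ler_pM //.
have [_ /(_ x xd)] := prod_XsubC_bound tsd; rewrite sts; apply: le_trans.
by rewrite horner_prod /w; under [in leRHS]eq_bigr do rewrite hornerXsubC.
Qed.

End Interpolation.

(** * Power series from converging coefficients *)

Section PowerSeries.
Variables (R : realType) (d : nat).
Implicit Types (x : 'rV[R]_d) (m : {ffun 'I_d -> nat}).

Definition monomial x m : R := \prod_i x 0 i ^+ m i.

Definition natf N (j : {ffun 'I_d -> 'I_N}) : {ffun 'I_d -> nat} :=
  [ffun i => nat_of_ord (j i)].

Lemma natf_inj N : injective (@natf N).
Proof.
move=> j k jk; apply/ffunP => i; apply: val_inj.
by have := congr1 (fun f : {ffun 'I_d -> nat} => f i) jk; rewrite !ffunE.
Qed.

Definition box N : {fset {ffun 'I_d -> nat}} :=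
  seq_fset tt [seq natf j | j : {ffun 'I_d -> 'I_N}].

Lemma in_box N m : (forall i, (m i < N)%N) -> m \in box N.
Proof.
move=> mN; rewrite seq_fsetE; apply/mapP.
exists [ffun i => Ordinal (mN i)]; first by rewrite mem_enum.
by apply/ffunP => i; rewrite !ffunE.
Qed.

Lemma sum_box N (u : {ffun 'I_d -> nat} -> R) :
  \sum_(m <- box N) u m = \sum_(j : {ffun 'I_d -> 'I_N}) u (natf j).
Proof.
rewrite (perm_big _ (seq_fset_perm _ _)) undup_id; last first.
  by rewrite map_inj_uniq ?enum_uniq //; exact: natf_inj.
by rewrite big_image.
Qed.

Lemma sum_fset_geometric (J : {fset {ffun 'I_d -> nat}}) :
  \sum_(m <- J) \prod_i 2^-1 ^+ m i <= 2 ^+ d :> R.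
Proof.
pose n := (\max_(m <- J) \max_i m i).+1.
have JB : (J `<=` box n)%fset.
  apply/fsubsetP => m mJ; apply: in_box => i; rewrite ltnS.
  apply: leq_trans (leq_bigmax i) _.
  exact: (@leq_bigmax_seq _ _ xpredT (fun m : {ffun 'I_d -> nat} => \max_i m i)).
pose u m : R := if m \in J then \prod_i 2^-1 ^+ m i else 0.
have -> : \sum_(m <- J) \prod_i 2^-1 ^+ m i = \sum_(m <- J) u m.
  by rewrite big_seq [RHS]big_seq; apply: eq_bigr => m mJ; rewrite /u mJ.
rewrite (big_fset_incl _ JB); last by move=> m _ mJ; rewrite /u (negbTE mJ).
rewrite sum_box.
apply: (@le_trans _ _ (\sum_(j : {ffun 'I_d -> 'I_n}) \prod_i 2^-1 ^+ j i)).
  apply: ler_sum => j _; rewrite /u; case: ifP => _.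
    by under eq_bigr do rewrite ffunE.
  by apply: prodr_ge0 => i _; rewrite exprn_ge0 ?invr_ge0.
rewrite -(bigA_distr_bigA (fun _ (k : 'I_n) => 2^-1 ^+ k : R)) /=.
rewrite -[in leRHS](card_ord d) -prodr_const; apply: ler_prod => i _; apply/andP; split.
  by apply: sumr_ge0 => k _; rewrite exprn_ge0 ?invr_ge0.
have : \sum_(k < n) 2^-1 ^+ k = 2 - 2 * 2^-1 ^+ n :> R.
  elim: n {JB u} => [|n IHn]; first by rewrite big_ord0 expr0 mulr1 subrr.
  by rewrite big_ord_recr /= IHn exprS; field.
by move=> ->; rewrite gerBl mulr_ge0 // exprn_ge0 ?invr_ge0.
Qed.

(** [u N - 2 C 2^-N] increases and [u N + 2 C 2^-N] decreases, so their
    common cut is a limit at the stated distance. *)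
Lemma geometric_limit (u : nat -> R) (C : R) :
  (forall N, `|u N.+1 - u N| <= C * 2^-1 ^+ N) ->
  exists l, forall N, `|l - u N| <= 2 * C * 2^-1 ^+ N.
Proof.
move=> uC; pose lo N := u N - 2 * C * 2^-1 ^+ N; pose hi N := u N + 2 * C * 2^-1 ^+ N.
have loS N : lo N <= lo N.+1.
  by rewrite /lo exprS; have := uC N; rewrite ler_norml => /andP[]; lra.
have hiS N : hi N.+1 <= hi N.
  by rewrite /hi exprS; have := uC N; rewrite ler_norml => /andP[]; lra.
have C0 N : 0 <= 2 * C * 2^-1 ^+ N.
  by have := le_trans (normr_ge0 _) (uC N); rewrite -mulrA; lra.
have lohi N M : lo N <= hi M.
  apply: (@le_trans _ _ (lo (maxn N M))).
    by apply: (homo_leq (r := <=%R)) => //; [exact: le_trans | exact: leq_maxl].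
  apply: (@le_trans _ _ (hi (maxn N M))).
    by rewrite /lo /hi; have := C0 (maxn N M); lra.
  apply: (homo_leq (r := fun a b => b <= a)) => //; last exact: leq_maxr.
  by move=> a b c ba ac; exact: le_trans ac ba.
exists (sup (range lo)) => N.
have h1 : lo N <= sup (range lo).
  apply: ub_le_sup; last by exists N.
  by exists (hi 0%N) => _ [M _ <-]; exact: lohi.
have h2 : sup (range lo) <= hi N.
  by apply: ge_sup; [exists (lo 0%N), 0%N | move=> _ [M _ <-]; exact: lohi].
by rewrite ler_norml; move: h1 h2; rewrite /lo /hi => h1 h2; apply/andP; split; lra.
Qed.

(** Halving the radius turns the bounds on [c m - a N m] into a convergent
    geometric series over the multi-indices, so that every finite set containing
    the box of size [N.+1] gives a partial sum at distance O(2^-N) of [F x]. *)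
Lemma power_series_limit (F : 'rV[R]_d -> R) (a : nat -> {ffun 'I_d -> nat} -> R)
    (delta C : R) :
  0 < delta ->
  (forall N m i, (N < m i)%N -> a N m = 0) ->
  (forall N m, `|a N.+1 m - a N m| * delta ^+ (\sum_i m i) <= C * 2^-1 ^+ N) ->
  (forall N x, (forall i, `|x 0 i| <= delta) ->
    `|F x - \sum_(j : {ffun 'I_d -> 'I_N.+1}) a N (natf j) * monomial x (natf j)|
      <= C * 2^-1 ^+ N) ->
  exists c : {ffun 'I_d -> nat} -> R, forall x,
    (forall i, `|x 0 i| <= delta / 2) ->
    summability.partial_sum (fun m => c m * monomial x m) @ summability.totally --> F x.
Proof.
move=> delta0 a0 aC FC.
have dp m : 0 < delta ^+ (\sum_i m i) by rewrite exprn_gt0.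
have /choice[c cE] : forall m, exists l, forall N,
    `|l - a N m| <= 2 * (C / delta ^+ (\sum_i m i)) * 2^-1 ^+ N.
  move=> m; apply: geometric_limit => N.
  by rewrite mulrAC ler_pdivlMr.
exists c => x xd; have PF := @summability.totally_filter {ffun 'I_d -> nat}.
apply/cvgrPdist_lt => e e0.
have C0 : 0 <= C.
  have z i : `|(0 : 'rV[R]_d) 0 i| <= delta by rewrite mxE normr0 ltW.
  by have := le_trans (normr_ge0 _) (FC 0%N 0 z); rewrite mulr1.
pose K := C + 2 * C * 2 ^+ d.
have [N NK] : exists N, K * 2^-1 ^+ N < e.
  have K0 : 0 <= K by rewrite addr_ge0 // !mulr_ge0 // exprn_ge0.
  have [N _ hN] : \forall N \near \oo, K * 2^-1 ^+ N < e.
    have : (fun N => K * 2^-1 ^+ N) @ \oo --> (0 : R).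
      rewrite -[X in _ --> X](mulr0 K); apply: cvgMr => //.
      by apply: cvg_expr; rewrite ger0_norm ?invr_ge0 // invf_lt1 ?ltr1n.
    move=> /cvgrPdist_lt/(_ _ e0); apply: filterS => N /=.
    by rewrite sub0r normrN; exact: le_lt_trans (ler_norm _).
  by exists N; apply: hN => /=.
exists (box N.+1) => //= J BJ; apply: le_lt_trans NK.
rewrite /summability.partial_sum -(big_seq_fsetE _ J (fun=> true) (fun m => c m * monomial x m)) /=.
have aJ : \sum_(m <- J) a N m * monomial x m =
    \sum_(j : {ffun 'I_d -> 'I_N.+1}) a N (natf j) * monomial x (natf j).
  rewrite -(sum_box _ (fun m => a N m * monomial x m)) -(big_fset_incl _ BJ) // => m _ mB.
  have [|] := boolP [exists i, (N < m i)%N].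
    by move=> /existsP[i /a0 ->]; rewrite mul0r.
  rewrite negb_exists => /forallP mN; move: mB; rewrite in_box // => i.
  by rewrite ltnS leqNgt.
have -> : F x - \sum_(m <- J) c m * monomial x m =
    (F x - \sum_(m <- J) a N m * monomial x m) - \sum_(m <- J) (c m - a N m) * monomial x m.
  under [X in _ - _ - X]eq_bigr do rewrite mulrBl.
  by rewrite sumrB opprB addrA subrK.
apply: (le_trans (ler_normB _ _)); rewrite /K mulrDl lerD //.
  by rewrite aJ; apply: FC => i; rewrite (le_trans (xd i)) // ler_pdivrMr // ler_pMr // ler1n.
apply: (le_trans (ler_norm_sum _ _ _)).
apply: (@le_trans _ _ (2 * C * 2^-1 ^+ N * \sum_(m <- J) \prod_i 2^-1 ^+ m i)).
  rewrite mulr_sumr; apply: ler_sum => m _; rewrite normrM.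
  apply: (@le_trans _ _ ((2 * (C / delta ^+ (\sum_i m i)) * 2^-1 ^+ N) *
    (delta ^+ (\sum_i m i) * \prod_i 2^-1 ^+ m i))).
    apply: ler_pM => //; rewrite /monomial normr_prod -prodrXr -big_split /=.
    apply: ler_prod => i _; rewrite normrX exprn_ge0 //=.
    by rewrite -exprMn lerXn2r ?nnegrE ?normr_ge0 // mulr_ge0 ?invr_ge0 // ltW.
  rewrite le_eqVlt; apply/orP; left; apply/eqP.
  by field; rewrite gt_eqF.
by rewrite [leRHS]mulrAC ler_wpM2l ?sum_fset_geometric // !mulr_ge0 // exprn_ge0 ?invr_ge0.
Qed.

End PowerSeries.

(** * Tensor product interpolation *)

Section TensorInterpolation.
Variables (R : realType) (d : nat) (delta : R).
Hypothesis delta0 : 0 < delta.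
Variables (F : 'rV[R]_d -> R).
Local Notation K := (ell_bound R).

Definition grid N (j : {ffun 'I_d -> 'I_N.+1}) : 'rV[R]_d := \row_i node delta N (j i).

Definition interp N (x : 'rV[R]_d) : R :=
  \sum_(j : {ffun 'I_d -> 'I_N.+1}) F (grid j) * \prod_i (ell delta (j i)).[x 0 i].

Definition icoef N (m : {ffun 'I_d -> nat}) : R :=
  \sum_(j : {ffun 'I_d -> 'I_N.+1}) F (grid j) * \prod_i (ell delta (j i))`_(m i).

Lemma icoef0 N (m : {ffun 'I_d -> nat}) i : (N < m i)%N -> icoef N m = 0.
Proof.
move=> Nm; rewrite /icoef big1 // => j _; rewrite (bigD1 i) //= nth_default ?mul0r ?mulr0 //.
by rewrite size_ell.
Qed.

Lemma interpE N x : interp N x =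
  \sum_(m : {ffun 'I_d -> 'I_N.+1}) icoef N (natf m) * monomial x (natf m).
Proof.
rewrite /interp; under [RHS]eq_bigr do rewrite mulr_suml.
rewrite exchange_big /=; apply: eq_bigr => j _.
have -> : \prod_i (ell delta (j i)).[x 0 i] =
    \prod_i \sum_(k < N.+1) (ell delta (j i))`_k * x 0 i ^+ k.
  by apply: eq_bigr => i _; rewrite (horner_coef_wide _ (n := N.+1)) ?size_ell.
rewrite bigA_distr_bigA /= mulr_sumr; apply: eq_bigr => m _.
rewrite -mulrA; congr (_ * _); rewrite /monomial -big_split /=.
by apply: eq_bigr => i _; rewrite ffunE.
Qed.

(** The interpolant of degree [N] is reproduced by interpolation of degree
    [N.+1], so its coefficients are read off its values on the finer grid. *)
Lemma icoef_refine N m : icoef N m =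
  \sum_(j : {ffun 'I_d -> 'I_N.+2}) interp N (grid j) * \prod_i (ell delta (j i))`_(m i).
Proof.
under [RHS]eq_bigr do rewrite mulr_suml.
rewrite exchange_big /=; apply: eq_bigr => j _.
have -> : \prod_i (ell delta (j i))`_(m i) =
    \prod_i \sum_(l < N.+2) (ell delta (j i)).[node delta N.+1 l] * (ell delta l)`_(m i).
  apply: eq_bigr => i _; have := ell_gen delta0 (N := N.+1) (p := ell delta (j i)).
  rewrite size_ell // => /(_ (leqnSn _)) {1}->; rewrite coef_sum.
  by apply: eq_bigr => l _; rewrite coefCM.
rewrite bigA_distr_bigA /= mulr_sumr; apply: eq_bigr => l _.
rewrite -mulrA; congr (_ * _); rewrite -big_split /=.
by apply: eq_bigr => i _; rewrite mxE.
Qed.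

Lemma sum_ell N (t : R) : \sum_(l < N.+1) (ell delta l).[t] = 1.
Proof.
have := ell_gen delta0 (N := N) (p := 1); rewrite size_poly1 => /(_ isT).
move=> /(congr1 (horner^~ t)); rewrite hornerC horner_sum => ->.
by apply: eq_bigr => l _; rewrite !hornerE.
Qed.

Definition updf N (j : {ffun 'I_d -> 'I_N}) i (l : 'I_N) : {ffun 'I_d -> 'I_N} :=
  [ffun k => if k == i then l else j k].

(** Averaging over one coordinate of the index: [(j, l)] and
    [(updf j i l, j i)] are exchanged by an involution. *)
Lemma sum_updf N (i : 'I_d) (phi : {ffun 'I_d -> 'I_N} -> R) :
  \sum_j \sum_l phi (updf j i l) = N%:R * \sum_j phi j.
Proof.
rewrite pair_big /=.
pose h (p : {ffun 'I_d -> 'I_N} * 'I_N) := (updf p.1 i p.2, p.1 i).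
have hK : involutive h.
  move=> [j l]; rewrite /h /=; congr pair; last by rewrite ffunE eqxx.
  by apply/ffunP => k; rewrite !ffunE; case: eqP => // ->.
rewrite (reindex_inj (inv_inj hK)) /=.
rewrite (eq_bigr (fun p => phi p.1)); last by move=> p _; rewrite -[p in RHS]hK.
rewrite -(pair_big xpredT xpredT (fun j _ => phi j)) /=.
rewrite mulr_sumr; apply: eq_bigr => j _.
by rewrite sumr_const card_ord mulr_natl.
Qed.

(** Replace the coordinates of [x] by grid points one after the other: each
    replacement costs one interpolation error in one variable, weighted by
    Lagrange polynomials in the other variables. *)
Lemma interp_error N (B : R) : 0 <= B ->
  (forall (x : 'rV[R]_d) (i : 'I_d) (s : seq R),
     (forall k, `|x 0 k| <= delta) -> uniq s -> size s = N.+2 ->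
     {in s, forall t, `|t| <= delta} -> `|dd s (fun t => F (upd x i t))| <= B) ->
  forall x : 'rV[R]_d, (forall k, `|x 0 k| <= delta) ->
  `|F x - interp N x| <=
    d%:R * (N.+1%:R ^+ d * (K ^+ N.+1) ^+ d * (B * (2 * delta) ^+ N.+1)).
Proof.
move=> B0 FB x xd.
set E := _ ^+ d * _ ^+ d * _.
(* The first [k] coordinates of [z k j] are moved to the grid. *)
pose z k (j : {ffun 'I_d -> 'I_N.+1}) : 'rV[R]_d :=
  \row_i (if (i < k)%N then node delta N (j i) else x 0 i).
pose w (j : {ffun 'I_d -> 'I_N.+1}) := \prod_i (ell delta (j i)).[x 0 i].
pose H k := \sum_j F (z k j) * w j.
have K1 : 1 <= K ^+ N.+1 by rewrite exprn_ege1 // ell_bound_ge1.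
have H0 : H 0%N = F x.
  rewrite /H (eq_bigr (fun j => F x * w j)); last first.
    by move=> j _; congr (F _ * _); apply/rowP => i; rewrite mxE.
  rewrite -mulr_sumr /w -(bigA_distr_bigA (fun i (l : 'I_N.+1) => (ell delta l).[x 0 i])) /=.
  by rewrite big1 ?mulr1 // => i _; exact: sum_ell.
have Hd : H d = interp N x.
  apply: eq_bigr => j _; congr (F _ * _); apply/rowP => i.
  by rewrite !mxE ltn_ord.
have HS k : (k < d)%N -> `|H k - H k.+1| <= E.
  move=> kd; pose i0 := Ordinal kd.
  have -> : H k - H k.+1 = N.+1%:R^-1 *
      \sum_j \sum_l (F (z k (updf j i0 l)) - F (z k.+1 (updf j i0 l))) * w (updf j i0 l).
    rewrite (sum_updf i0 (fun j => (F (z k j) - F (z k.+1 j)) * w j)) mulKf ?pnatr_eq0 //.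
    by rewrite /H -sumrB; apply: eq_bigr => j _; rewrite mulrBl.
  (* The sum over the index in coordinate [i0] is one interpolation error; the
     sum over the other indices is bounded term by term. *)
  have step j : `|\sum_l (F (z k (updf j i0 l)) - F (z k.+1 (updf j i0 l))) * w (updf j i0 l)|
      <= (K ^+ N.+1) ^+ d * (B * (2 * delta) ^+ N.+1).
    pose y := z k j; pose rest := \prod_(i | i != i0) (ell delta (j i)).[x 0 i].
    have yd i : `|y 0 i| <= delta.
      by rewrite mxE; case: ifP => _; [exact: node_le | exact: xd].
    have z0 l : z k (updf j i0 l) = y.
      apply/rowP => i; rewrite !mxE; case: ltnP => // ik; rewrite ffunE.
      by case: eqP => // ii; move: ik; rewrite ii /= ltnn.
    have yi0 : upd y i0 (x 0 i0) = y.
      by apply/rowP => i; rewrite !mxE; case: eqP => // ->; rewrite /= ltnn.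
    have z1 l : z k.+1 (updf j i0 l) = upd y i0 (node delta N l).
      apply/rowP => i; rewrite !mxE ffunE ltnS leq_eqVlt.
      have -> : (nat_of_ord i == k) = (i == i0) by [].
      by case: eqP.
    have wE l : w (updf j i0 l) = (ell delta l).[x 0 i0] * rest.
      rewrite /w (bigD1 i0) //= ffunE eqxx; congr (_ * _).
      by apply: eq_bigr => i /negbTE ii; rewrite ffunE ii.
    have -> : \sum_l (F (z k (updf j i0 l)) - F (z k.+1 (updf j i0 l))) * w (updf j i0 l) =
       rest * (F (upd y i0 (x 0 i0)) - \sum_(l < N.+1) F (upd y i0 (node delta N l)) * (ell delta l).[x 0 i0]).
      rewrite -[F (upd y i0 (x 0 i0))]mulr1 -(sum_ell N (x 0 i0)) mulr_sumr -sumrB mulr_sumr.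
      by apply: eq_bigr => l _; rewrite z0 z1 wE yi0; ring.
    rewrite normrM ler_pM //.
      rewrite normr_prod; apply: (@le_trans _ _ (\prod_(i < d | i != i0) K ^+ N.+1)).
        by apply: ler_prod => i _; rewrite normr_ge0; case: (ell_bounds delta0 (j i)) => _; exact.
      rewrite big_mkcond /= -[in leRHS](card_ord d) -prodr_const.
      apply: ler_prod => i _; case: ifP => _; rewrite ?lexx ?K1 ?ler01 //.
      by rewrite (le_trans ler01 K1).
    apply: (interp1_error delta0 (g := fun t => F (upd y i0 t)) B0) => // s us ss sd.
    exact: FB.
  rewrite normrM ger0_norm ?invr_ge0 ?ler0n //.
  apply: (@le_trans _ _ (1 * \sum_(j : {ffun 'I_d -> 'I_N.+1}) (K ^+ N.+1) ^+ d * (B * (2 * delta) ^+ N.+1))).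
    apply: ler_pM => //.
      by rewrite invf_le1 ?ltr0n // ler1n.
    by apply: (le_trans (ler_norm_sum _ _ _)); apply: ler_sum.
  by rewrite mul1r sumr_const card_ffun !card_ord /E -[leLHS]mulr_natl natrX mulrA.
have : forall k, (k <= d)%N -> `|H 0%N - H k| <= k%:R * E.
  elim=> [|k IHk] kd; first by rewrite subrr normr0 mul0r.
  have -> : H 0%N - H k.+1 = (H 0%N - H k) + (H k - H k.+1) by rewrite addrA subrK.
  rewrite -natr1 mulrDl mul1r (le_trans (ler_normD _ _)) // lerD ?HS //.
  by apply: IHk; exact: ltnW.
by move=> /(_ d (leqnn d)); rewrite H0 Hd.
Qed.

Lemma icoef_step N m (e : R) :
  (forall x : 'rV[R]_d, (forall k, `|x 0 k| <= delta) -> `|F x - interp N x| <= e) ->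
  `|icoef N.+1 m - icoef N m| * delta ^+ (\sum_i m i) <=
    N.+2%:R ^+ d * ((K ^+ N.+2) ^+ d * e).
Proof.
move=> Fe; have e0 : 0 <= e.
  have z k : `|(0 : 'rV[R]_d) 0 k| <= delta by rewrite mxE normr0 ltW.
  exact: le_trans (normr_ge0 _) (Fe _ z).
rewrite (icoef_refine N m) /icoef -sumrB.
have dm : 0 <= delta ^+ (\sum_i m i) by rewrite exprn_ge0 // ltW.
rewrite -[delta ^+ _](ger0_norm dm) -normrM mulr_suml.
apply: (le_trans (ler_norm_sum _ _ _)).
apply: (@le_trans _ _ (\sum_(j : {ffun 'I_d -> 'I_N.+2}) (K ^+ N.+2) ^+ d * e)); last first.
  by rewrite sumr_const card_ffun !card_ord -[leLHS]mulr_natl natrX.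
apply: ler_sum => j _; rewrite -mulrBl mulrAC -mulrA [_ * (_ * _)]mulrC normrM ler_pM //; last first.
  by apply: Fe => k; rewrite mxE; exact: node_le.
rewrite mulrC -prodrXr -big_split normr_prod /= -[in leRHS](card_ord d) -prodr_const.
apply: ler_prod => i _; rewrite normr_ge0 normrM (ger0_norm (exprn_ge0 _ (ltW delta0))) /=.
by case: (ell_bounds delta0 (j i)).
Qed.

End TensorInterpolation.

(** * Analyticity *)

(** The number of grid points and the Lagrange polynomials contribute
    a factor [A] per degree to the interpolation error, and another one to the
    coefficients; the choice of
    [delta] makes the resulting ratio [8 * delta * A ^+ 2] equal to [1/2]. *)
Lemma power_series_of_dd_bound (R : realType) (d : nat) (F : 'rV[R]_d -> R) (M : R) :
  0 <= M ->
  (forall (x : 'rV[R]_d) (i : 'I_d) (s : seq R) N, (forall k, `|x 0 k| <= 4^-1) ->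
    uniq s -> size s = N.+2 -> {in s, forall t, `|t| <= 4^-1} ->
    `|dd s (fun t => F (upd x i t))| <= M * 4 ^+ N) ->
  exists2 rho : R, 0 < rho & exists c : {ffun 'I_d -> nat} -> R,
    forall x : 'rV[R]_d, (forall i, `|x 0 i| <= rho) ->
    summability.partial_sum (fun m => c m * monomial x m) @ summability.totally --> F x.
Proof.
move=> M0 FM; pose K := ell_bound R; pose A := (2 * K) ^+ d.
have K1 : 1 <= K := ell_bound_ge1 R.
have A1 : 1 <= A by rewrite exprn_ege1 //; lra.
have AA1 : 1 <= A ^+ 2 by rewrite exprn_ege1.
pose delta : R := (16 * A ^+ 2)^-1.
have delta0 : 0 < delta by rewrite invr_gt0; lra.
have delta4 : delta <= 4^-1 by rewrite lef_pV2 ?posrE; lra.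
have growth n : n.+1%:R ^+ d * (K ^+ n.+1) ^+ d <= A ^+ n.+1.
  rewrite -exprMn; have -> : A ^+ n.+1 = (2 ^+ n.+1 * K ^+ n.+1) ^+ d by rewrite /A exprAC exprMn.
  have Kn : 0 <= K ^+ n.+1 by rewrite exprn_ge0 //; lra.
  apply: lerXn2r; rewrite ?nnegrE; [exact: mulr_ge0 | by rewrite mulr_ge0 // exprn_ge0 |].
  by rewrite ler_wpM2r // -natrX ler_nat ltnW // ltn_expl.
pose D := d%:R * M * A * (2 * delta).
have D0 : 0 <= D by rewrite /D !mulr_ge0 //; lra.
have err N (x : 'rV[R]_d) : (forall k, `|x 0 k| <= delta) ->
    `|F x - interp delta F N x| <= D * (8 * delta * A) ^+ N.
  move=> xd; have B0 : 0 <= M * 4 ^+ N by rewrite mulr_ge0 ?exprn_ge0.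
  apply: le_trans (interp_error delta0 B0 _ xd) _.
    move=> y i s yd us ss sd; apply: FM => // [k|t /sd]; first exact: le_trans (yd k) delta4.
    by move=> td; exact: le_trans td delta4.
  have -> : D * (8 * delta * A) ^+ N =
      d%:R * (A ^+ N.+1 * (M * 4 ^+ N * (2 * delta) ^+ N.+1)).
    rewrite /D (_ : 8 * delta * A = A * 4 * (2 * delta)); last by ring.
    by rewrite !exprMn !exprS; ring.
  rewrite ler_wpM2l //; apply: ler_wpM2r (growth N).
  by rewrite mulr_ge0 // exprn_ge0 // mulr_ge0 // ltW.
pose C := A ^+ 2 * D.
have q2 : 8 * delta * A ^+ 2 = 2^-1.
  have A0 : A != 0 by rewrite gt_eqF //; lra.
  by rewrite /delta; field; rewrite A0.
have coef_step N m : `|icoef delta F N.+1 m - icoef delta F N m| * delta ^+ (\sum_i m i)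
    <= C * 2^-1 ^+ N.
  apply: le_trans (icoef_step delta0 m (@err N)) _.
  rewrite mulrA; apply: (@le_trans _ _ (A ^+ N.+2 * (D * (8 * delta * A) ^+ N))).
    by rewrite ler_wpM2r ?growth // mulr_ge0 // exprn_ge0 // !mulr_ge0 //; lra.
  rewrite /C -q2 le_eqVlt; apply/orP; left; apply/eqP.
  have -> : 8 * delta * A ^+ 2 = A * (8 * delta * A) by ring.
  by rewrite [(A * _) ^+ N]exprMn 2!exprS expr2; ring.
have err2 N (x : 'rV[R]_d) : (forall i, `|x 0 i| <= delta) ->
    `|F x - \sum_(j : {ffun 'I_d -> 'I_N.+1}) icoef delta F N (natf j) * monomial x (natf j)|
      <= C * 2^-1 ^+ N.
  move=> xd; rewrite -(interpE delta0 F N x); apply: le_trans (err N x xd) _.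
  have h1 : D <= C by rewrite /C ler_peMl.
  have h2 : 8 * delta * A <= 2^-1.
    by rewrite -q2 ler_wpM2l ?mulr_ge0 //; [lra | rewrite expr2 ler_peMl //; lra].
  have h0 : 0 <= 8 * delta * A by rewrite !mulr_ge0 //; lra.
  by apply: ler_pM => //; rewrite ?exprn_ge0 // lerXn2r ?nnegrE // invr_ge0.
have [c cF] := power_series_limit delta0 (fun N m i => @icoef0 R d delta delta0 F N m i) coef_step err2.
exists (delta / 2); first by lra.
by exists c.
Qed.

Theorem theorem1p2 (R : realType) (d : nat) (E : set 'rV[R]_d)
    (f : 'rV[R]_d -> R) :
  open E -> locally_matrix_monotone E f -> real_analytic_on E f.
Proof.
move=> oE fmon a Ea.
have [e e0 aE] : exists2 e : R, 0 < e & forall x : 'rV[R]_d, (forall i, `|x 0 i - a 0 i| < e) -> E x.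
  have : nbhs a E by exact: open_nbhs_nbhs.
  move=> /nbhs_ballP[e e0 aE]; exists e => // x xa; apply: aE; split=> // i j.
  by rewrite ord1 /ball /= distrC; exact: xa.
pose r := e / 2; have r0 : 0 < r by rewrite /r; lra.
have cubeE (x : 'rV[R]_d) : (forall i, `|x 0 i - a 0 i| <= r) -> E x.
  by move=> xa; apply: aE => i; apply: le_lt_trans (xa i) _; rewrite /r; lra.
pose F (y : 'rV[R]_d) := f (a + r *: y).
(* [F] lies between its values at two opposite corners of the cube. *)
pose M := `|F (const_mx (-1))| + `|F (const_mx 1)|.
have monoF (x y : 'rV[R]_d) : (forall i, -1 <= x 0 i) -> (forall i, x 0 i <= y 0 i) ->
    (forall i, y 0 i <= 1) -> F x <= F y.
  move=> x1 xy y1; apply: (locally_matrix_monotone_le fmon) => [i|t /andP[t0 t1]].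
    by rewrite !mxE lerD2l ler_pM2l.
  apply: cubeE => i; rewrite !mxE.
  have -> : a 0 i + r * x 0 i + t * (a 0 i + r * y 0 i - (a 0 i + r * x 0 i)) - a 0 i =
    r * ((1 - t) * x 0 i + t * y 0 i) by ring.
  rewrite normrM (ger0_norm (ltW r0)) ger_pMr // ler_norml.
  have := x1 i; have := xy i; have := y1 i => *; apply/andP; split; nra.
have FM (y : 'rV[R]_d) : (forall i, `|y 0 i| <= 1) -> `|F y| <= M.
  move=> y1; have lo : F (const_mx (-1)) <= F y.
    by apply: monoF => i; rewrite ?mxE //; have := y1 i; rewrite ler_norml => /andP[].
  have hi : F y <= F (const_mx 1).
    by apply: monoF => i; rewrite ?mxE //; have := y1 i; rewrite ler_norml => /andP[].
  rewrite ler_norml /M; have := ler_norm (F (const_mx 1)); have := ler_norm (- F (const_mx (-1))).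
  have := normr_ge0 (F (const_mx 1)); have := normr_ge0 (F (const_mx (-1))); rewrite normrN.
  by move=> *; apply/andP; split; lra.
have M0 : 0 <= M by rewrite addr_ge0.
have updP (y : 'rV[R]_d) i t : (forall k, `|y 0 k| <= 1) -> `|t| <= 1 -> forall k, `|upd y i t 0 k| <= 1.
  by move=> y1 t1 k; rewrite mxE; case: eqP.
have FL (y : 'rV[R]_d) i : (forall k, `|y 0 k| <= 1) -> loewner (fun t => F (upd y i t)).
  move=> y1; pose x := upd (a + r *: y) i (a 0 i).
  have xE t : upd x i (x 0 i + r * t) = a + r *: upd y i t.
    by apply/rowP => k; rewrite !mxE eqxx; case: eqP => // ->.
  have -> : (fun t => F (upd y i t)) = fun t => f (upd x i (x 0 i + r * t)).
    by apply/funext => t; rewrite xE.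
  apply: (locally_matrix_monotone_loewner fmon r0) => t t1; rewrite xE; apply: cubeE => k.
  rewrite !mxE addrAC subrr add0r normrM (ger0_norm (ltW r0)) ger_pMr //.
  by have := updP y i t y1 t1 k; rewrite mxE.
have [|rho rho0 [c cF]] := @power_series_of_dd_bound R d F (12 * M) (mulr_ge0 (ler0n _ _) M0).
  move=> y i s N y4 us ss s4.
  have y1 k : `|y 0 k| <= 1 by apply: le_trans (y4 k) _; lra.
  apply: (loewner_dd_bound (FL y i y1)) => // t t1.
  by apply: FM; exact: updP.
(* Undo the rescaling of the cube by [r]. *)
exists (fun m => c m / r ^+ (\sum_i m i)).
apply/nbhs_ballP; exists (r * rho); first by rewrite /= mulr_gt0.
move=> x [_ xa].
pose y : 'rV[R]_d := r^-1 *: (x - a).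
have -> : f x = F y.
  by rewrite /F /y scalerA mulfV ?gt_eqF // scale1r addrC subrK.
have -> : (fun m : {ffun 'I_d -> nat} => c m / r ^+ (\sum_i m i) *
    \prod_(i < d) (x 0 i - a 0 i) ^+ m i) = fun m => c m * monomial y m.
  apply/funext => m; rewrite -mulrA; congr (_ * _).
  rewrite -exprVn -prodrXr -big_split; apply: eq_bigr => i _ /=.
  by rewrite !mxE exprMn.
apply: cF => i; rewrite !mxE normrM ger0_norm ?invr_ge0 ?(ltW r0) //.
rewrite mulrC ler_pdivrMr // mulrC ltW //.
have := xa 0 i; rewrite /ball /= distrC; by [].
Qed.
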